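(* Let $j=2\pi\sqrt{-1}$ and let $N$ be the Lie group of all matrices $$n=\begin{pmatrix}1&0&0&0&f\\0&1&0&0&0\\0&0&e^{ja}&0&b\\0&0&0&1&a\\0&0&0&0&1\end{pmatrix},\qquad a,f\in\mathbf R,\ b\in\mathbf C.$$ Identify $\mathfrak n^*$ with $\mathbf R\times\mathbf C\times\mathbf R$ by letting $(p,z,t)$ denote the value at the identity of $p\,da+\operatorname{Re}(\bar z\,db)-t\,df$, and let $U=\{(p,e^{jq},1):p,q\in\mathbf R\}$, a coadjoint orbit of $N$ with $\omega_U=dp\wedge dq$. Let $\mathbf T^2=\{(e^{jr},e^{js}):r,s\in\mathbf R\}$, and let $X$ be the quotient of the symplectic manifold $(\mathbf R^2\times\mathbf T^2,\ dp\wedge dq+dr\wedge ds)$ by the $\mathbf Z$-action $$k\bigl(p,q,e^{jr},e^{js}\bigr)=\bigl(p,q+k,e^{j(r+ks)},e^{js}\bigr),\qquad k\in\mathbf Z,$$ with the induced 2-form, the $N$-action induced by $n(p,q)=\bigl(p+\operatorname{Re}(\overline{jb}\,e^{j(q+a)}),\,q+a\bigr)$ on $\mathbf R^2$ (and trivial action on $\mathbf T^2$), and the moment map induced by $(p,q,\cdot,\cdot)\mapsto(p,e^{jq},1)$. Then $X$ is a primary $N$-space over $U$, and $X$ is not homeomorphic to the product of any covering of $U$ by any surface.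
   Context: A hamiltonian $N$-space is a symplectic manifold with a symplectic $N$-action and an $N$-equivariant moment map to $\mathfrak n^*$; it is primary over a coadjoint orbit $U$ if the image of the moment map is $U$. A surface means a 2-dimensional topological manifold. The plane $\mathbf R^2\ni(p,q)$ is the universal covering $\tilde U$ of the cylinder $U$ via $(p,q)\mapsto(p,e^{jq},1)$. *)

(* Defs.v *)
From HB Require Import structures.
From mathcomp Require Import all_boot all_order all_algebra generic_quotient.
From mathcomp Require Import complex.
From mathcomp Require Import all_classical all_reals all_analysis.

Set Implicit Arguments.
Unset Strict Implicit.
Unset Printing Implicit Defensive.

Import Order.TTheory GRing.Theory Num.Theory numFieldNormedType.Exports.

Local Open Scope classical_set_scope.
Local Open Scope complex_scope.
Local Open Scope ring_scope.

Definition homeomorphic (X Y : topologicalType) : Prop :=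
  exists (f : X -> Y) (g : Y -> X),
    [/\ continuous f, continuous g, cancel f g & cancel g f].

(* Empty fibres are allowed. *)
Definition covering (C B : topologicalType) (f : C -> B) : Prop :=
  continuous f /\
  forall b : B, exists V : set B,
    [/\ open V, V b &
      exists (I : Type) (W : I -> set C),
        [/\ forall i, open (W i),
            trivIset setT W,
            f @^-1` V = \bigcup_i W i &
            forall i, exists s : B -> C,
              [/\ {within V, continuous s},
                  forall v, V v -> W i (s v) /\ f (s v) = v &
                  forall w, W i w -> s (f w) = w]]].

Section Manifold.
Variable R : realType.

(* [cmap] is only meaningful on [cdom], and [cinv] on [cimg]. *)
Record chart (X : Type) (n : nat) := Chart {
  cdom : set X;
  cmap : X -> 'rV[R]_n;
  cinv : 'rV[R]_n -> X }.

Definition cimg X n (c : chart X n) : set 'rV[R]_n := cmap c @` cdom c.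

Definition is_chart (X : topologicalType) n (c : chart X n) : Prop :=
  [/\ open (cdom c),
      open (cimg c),
      {within cdom c, continuous (cmap c)},
      {within cimg c, continuous (cinv c)} &
      forall x, cdom c x -> cinv c (cmap c x) = x].

Definition surface (S : topologicalType) : Prop :=
  [/\ hausdorff_space S,
      @second_countable S &
      forall x : S, exists2 c : chart S 2, is_chart c & cdom c x].

Definition basis_vec n (i : 'I_n) : 'rV[R]_n := delta_mx 0 i.

Fixpoint C_k (k n : nat) (V : normedModType R) (O : set 'rV[R]_n)
    (f : 'rV[R]_n -> V) : Prop :=
  (forall y, O y -> {for y, continuous f}) /\
  (if k is k'.+1 then
     forall i : 'I_n,
       (forall y, O y -> derivable f y (basis_vec i)) /\
       C_k k' O (fun y => 'D_(basis_vec i) f y)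
   else True).

Definition smooth_on n (V : normedModType R) (O : set 'rV[R]_n)
    (f : 'rV[R]_n -> V) : Prop :=
  open O /\ forall k, C_k k O f.

Definition local_expr X Y m n (f : X -> Y) (c : chart X m) (d : chart Y n) :
    'rV[R]_m -> 'rV[R]_n :=
  fun y => cmap d (f (cinv c y)).

Definition smooth_map (X Y : topologicalType) m n (A : set (chart X m))
    (B : set (chart Y n)) (f : X -> Y) : Prop :=
  continuous f /\
  forall c d, A c -> B d ->
    smooth_on (cmap c @` (cdom c `&` f @^-1` cdom d)) (local_expr f c d).

Definition smooth_manifold (X : topologicalType) n (A : set (chart X n)) :
    Prop :=
  [/\ hausdorff_space X,
      @second_countable X,
      forall c, A c -> is_chart c,
      forall x, exists2 c, A c & cdom c x &
      forall c d, A c -> A d ->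
        smooth_on (cmap c @` (cdom c `&` cdom d)) (local_expr id c d)].

(* All the charts that are local inverses of [f]. *)
Definition param_atlas (X : topologicalType) n (f : 'rV[R]_n -> X) :
    set (chart X n) :=
  [set c | is_chart c /\ forall y, cimg c y -> cinv c y = f y].

Definition vec_atlas n : set (chart 'rV[R]_n n) :=
  [set Chart setT id id].

Definition prod_chart X Y m n (c : chart X m) (d : chart Y n) :
    chart (X * Y) (m + n) :=
  Chart (cdom c `*` cdom d)
        (fun xy => row_mx (cmap c xy.1) (cmap d xy.2))
        (fun w => (cinv c (lsubmx w), cinv d (rsubmx w))).

Definition prod_atlas X Y m n (A : set (chart X m)) (B : set (chart Y n)) :
    set (chart (X * Y) (m + n)) :=
  [set e | exists c d, [/\ A c, B d & e = prod_chart c d]].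

(* A 2-form is given by its matrix in each chart of the atlas:
   [w c y] is the matrix at the point with coordinates [y], and its value on
   the vectors with components u, v is [u *m w c y *m v^T]. *)
Definition form2 X n := chart X n -> 'rV[R]_n -> 'M[R]_n.

(* w = f^* th.  Tangent vectors are rows, so the derivative of g maps u to
   [u *m 'J g y]. *)
Definition is_pullback (X Y : topologicalType) m n
    (A : set (chart X m)) (w : form2 X m)
    (B : set (chart Y n)) (th : form2 Y n) (f : X -> Y) : Prop :=
  forall c d x, A c -> B d -> cdom c x -> cdom d (f x) ->
    let J := jacobian (local_expr f c d) (cmap c x) in
    w c (cmap c x) = J *m th d (cmap d (f x)) *m J^T.

Definition is_form2 (X : topologicalType) n (A : set (chart X n))
    (w : form2 X n) : Prop :=
  [/\ forall c, A c -> smooth_on (cimg c) (w c),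
      forall c y, A c -> cimg c y -> (w c y)^T = - w c y &
      is_pullback A w A w id].

Definition closed_form2 X n (A : set (chart X n)) (w : form2 X n) : Prop :=
  forall c y, A c -> cimg c y -> forall i j k : 'I_n,
    'D_(basis_vec i) (fun z => w c z j k) y
    + 'D_(basis_vec j) (fun z => w c z k i) y
    + 'D_(basis_vec k) (fun z => w c z i j) y = 0.

Definition symplectic_manifold (X : topologicalType) n (A : set (chart X n))
    (w : form2 X n) : Prop :=
  [/\ smooth_manifold A,
      is_form2 A w,
      closed_form2 A w &
      forall c y, A c -> cimg c y -> w c y \in unitmx].

End Manifold.

Section GroupN.
Variable R : realType.

(* [R[i]^o] is [R[i]] with its topology. *)
Definition C := (R[i])^o.

Definition j : C := Complex 0 (pi *+ 2).

(* e^{jq} *)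
Definition expj (q : R) : C := Complex (cos (pi *+ 2 * q)) (sin (pi *+ 2 * q)).

Definition mx5 (s : seq (seq R[i])) : 'M[R[i]]_5 :=
  \matrix_(i, k) nth 0 (nth [::] s i) k.

Definition nmat (a : R) (b : C) (f : R) : 'M[R[i]]_5 := mx5
  [:: [:: 1; 0; 0;      0; f%:C];
      [:: 0; 1; 0;      0; 0   ];
      [:: 0; 0; expj a; 0; b   ];
      [:: 0; 0; 0;      1; a%:C];
      [:: 0; 0; 0;      0; 1   ]].

Definition N : set 'M[R[i]]_5 :=
  [set n | exists a b f, n = nmat a b f].

Definition acoord (n : 'M[R[i]]_5) : R := complex.Re (n (inord 3) (inord 4)).
Definition bcoord (n : 'M[R[i]]_5) : C := n (inord 2) (inord 4).
Definition fcoord (n : 'M[R[i]]_5) : R := complex.Re (n (inord 0) (inord 4)).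

(* The global chart (a, Re b, Im b, f) that makes N a Lie group. *)
Definition nparam (y : 'rV[R]_4) : 'M[R[i]]_5 :=
  nmat (y 0 (inord 0)) (Complex (y 0 (inord 1)) (y 0 (inord 2)))
       (y 0 (inord 3)).

(* The tangent space to N at the identity; on it da, db, df are [acoord],
   [bcoord], [fcoord]. *)
Definition nalg : set 'M[R[i]]_5 :=
  [set Z | exists (a : R) (b : C) (f : R), Z = mx5
    [:: [:: 0; 0; 0;        0; f%:C];
        [:: 0; 0; 0;        0; 0   ];
        [:: 0; 0; j * a%:C; 0; b   ];
        [:: 0; 0; 0;        0; a%:C];
        [:: 0; 0; 0;        0; 0   ]]].

(* A curve in N through the identity with velocity Z in [nalg]. *)
Definition ncurve (Z : 'M[R[i]]_5) (t : R) : 'M[R[i]]_5 :=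
  nmat (t * acoord Z) (t%:C * bcoord Z) (t * fcoord Z).

(* (p, z, t) stands for p da + Re (conj z db) - t df. *)
Definition dual : topologicalType := (R * C * R)%type.

Definition pairing (x : dual) (Z : 'M[R[i]]_5) : R :=
  let: (p, z, t) := x in
  p * acoord Z + complex.Re (conjc z * bcoord Z) - t * fcoord Z.

(* y = n . x, where <n . x, Z> = <x, n^-1 Z n> *)
Definition coadjoint (n : 'M[R[i]]_5) (x y : dual) : Prop :=
  forall Z, nalg Z -> pairing y Z = pairing x (invmx n *m Z *m n).

Definition coadjoint_orbit (U : set dual) : Prop :=
  exists x : dual, U = [set y | exists2 n, N n & coadjoint n x y].

Definition bracket (Z Z' : 'M[R[i]]_5) := Z *m Z' - Z' *m Z.

End GroupN.

Section Hamiltonian.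
Variables (R : realType) (X : topologicalType) (n : nat).
Variables (A : set (chart R X n)) (w : form2 R X n).
Variables (act : 'M[R[i]]_5 -> X -> X) (mom : X -> dual R).

Definition symplectic_action : Prop :=
  [/\ forall x, act 1%:M x = x,
      forall g h x, N g -> N h -> act (g *m h) x = act g (act h x),
      smooth_map (prod_atlas (vec_atlas (R := R) (n := 4)) A) A
        (fun yx => act (nparam yx.1) yx.2) &
      forall g, N g -> is_pullback A w A w (act g)].

(* Components in the chart c of the infinitesimal action of Z at x, i.e. the
   image of Z by the derivative at the identity of g |-> act g x. *)
Definition fund_vec (Z : 'M[R[i]]_5) (c : chart R X n) (x : X) : 'rV[R]_n :=
  derive1 (fun t : R => cmap c (act (ncurve Z t) x)) 0.

(* w(Z_X, .) = - d <mom, Z>; this is the sign for which the inclusion of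
   (U, dp /\ dq) in the dual is a moment map. *)
Definition moment_map : Prop :=
  forall Z, nalg Z -> forall c, A c ->
    let H := fun y => pairing (mom (cinv c y)) Z : R^o in
    smooth_on (cimg c) H /\
    forall x (v : 'rV[R]_n), cdom c x ->
      (fund_vec Z c x *m w c (cmap c x) *m v^T) 0 0 = - 'D_v H (cmap c x).

Definition equivariant_moment : Prop :=
  forall g x, N g -> coadjoint g (mom x) (mom (act g x)).

Definition hamiltonian_space : Prop :=
  [/\ symplectic_manifold A w, symplectic_action, moment_map &
      equivariant_moment].

Definition primary_space (U : set (dual R)) : Prop :=
  [/\ coadjoint_orbit U, hamiltonian_space & mom @` setT = U].

End Hamiltonian.

Section OrbitU.
Variable R : realType.

Definition uparam (p q : R) : dual R := (p, expj q, 1).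

Definition U : set (dual R) := [set x | exists p q, x = uparam p q].

(* (dp, dq) are the components of the value at [uparam p q] of the
   infinitesimal coadjoint action of Z. *)
Definition coadjoint_vec (Z : 'M[R[i]]_5) (p q dp dq : R) : Prop :=
  forall W, nalg W ->
    derive1 (fun t : R => pairing (uparam (p + t * dp) (q + t * dq)) W : R^o) 0
    = pairing (uparam p q) (bracket W Z).

(* The orbit 2-form, w(Z(x), Z'(x)) = <x, [Z', Z]>, is dp /\ dq. *)
Definition orbit_form_dpdq : Prop :=
  forall Z Z', nalg Z -> nalg Z' -> forall p q dp dq dp' dq' : R,
    coadjoint_vec Z p q dp dq -> coadjoint_vec Z' p q dp' dq' ->
    dp * dq' - dq * dp' = pairing (uparam p q) (bracket Z' Z).

End OrbitU.

Section SpaceX.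
Variable R : realType.

Definition T2 : set (C R * C R) :=
  [set u | exists r s, u = (expj r, expj s)].

Lemma T2_subproof (r s : R) : (expj r, expj s) \in T2.
Proof. by rewrite inE; exists r, s. Qed.

Definition torus (r s : R) : T2 := SigSub (T2_subproof r s).

Lemma torus_surj (u : T2) : exists r s, u = torus r s.
Proof.
case: u => u uT; have [r [s e]] := set_mem uT.
by exists r, s; apply/val_inj.
Qed.

Definition M : topologicalType := (R * R * T2)%type.

Lemma expjD (r s : R) : expj (r + s) = expj r * expj s.
Proof.
by rewrite /expj mulrDr cosD sinD; congr Complex; rewrite addrC// mulrC.
Qed.

Lemma expj0 : expj (0 : R) = 1.
Proof. by rewrite /expj mulr0 cos0 sin0. Qed.

Lemma expjN (r : R) : expj (- r) = (expj r)^-1.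
Proof.
have h : expj r * expj (- r) = 1 by rewrite -expjD subrr expj0.
have u : expj r != 0.
  by apply/eqP => e; move/eqP: h; rewrite e mul0r eq_sym oner_eq0.
by apply: (mulfI u); rewrite h mulfV.
Qed.

Lemma expjMn (n : nat) (s : R) : expj (n%:R * s) = expj s ^+ n.
Proof.
elim: n => [|n IH]; first by rewrite mul0r expj0 expr0.
by rewrite -natr1 mulrDl mul1r expjD IH exprSr.
Qed.

Lemma expjM (k : int) (s : R) : expj (k%:~R * s) = expj s ^ k.
Proof.
case: k => n; first by rewrite -pmulrn expjMn.
by rewrite NegzE mulrNz mulNr expjN -pmulrn expjMn.
Qed.

Lemma zact_subproof (k : int) (u : T2) :
  ((val u).1 * (val u).2 ^ k, (val u).2) \in T2.
Proof.
have [r [s ->]] := torus_surj u; rewrite inE; exists (r + k%:~R * s), s.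
by rewrite expjD expjM.
Qed.

Definition zact (k : int) (x : M) : M :=
  let: (p, q, u) := x in (p, q + k%:~R, SigSub (zact_subproof k u)).

Lemma zactE (k : int) (p q r s : R) :
  zact k (p, q, torus r s) = (p, q + k%:~R, torus (r + k%:~R * s) s).
Proof. by congr (_, _); apply/val_inj; rewrite /= expjD expjM. Qed.

Definition zorbit (x y : M) : bool := `[< exists k, zact k x = y >].

Lemma zorbit_equiv : equiv_class_of zorbit.
Proof.
have act0 x : zact 0 x = x.
  case: x => -[p q] u; have [r [s ->]] := torus_surj u.
  by rewrite zactE mul0r !addr0.
have actD k l x : zact k (zact l x) = zact (k + l) x.
  case: x => -[p q] u; have [r [s ->]] := torus_surj u.
  rewrite !zactE; congr (_, _, torus _ _).
    by rewrite -addrA -intrD [l + k]addrC.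
  by rewrite -addrA -mulrDl -intrD [l + k]addrC.
split => [x|x y|y x z].
- by apply/asboolP; exists 0.
- by apply/asboolP/asboolP => -[k <-]; exists (- k); rewrite actD addNr act0.
- move=> /asboolP[k <-] /asboolP[l <-]; apply/asboolP.
  by exists (l + k); rewrite actD.
Qed.

Canonical zorbit_equivRel := EquivRelPack zorbit_equiv.

Definition X : topologicalType :=
  quotient_topology {eq_quot zorbit_equivRel}%qT.

Definition proj (x : M) : X := (\pi_X x)%qT.

Definition Mparam (y : 'rV[R]_4) : M :=
  (y 0 (inord 0), y 0 (inord 1), torus (y 0 (inord 2)) (y 0 (inord 3))).

Definition Matlas : set (chart R M 4) := param_atlas Mparam.
Definition Xatlas : set (chart R X 4) := param_atlas (proj \o Mparam).

(* The matrix of dp /\ dq + dr /\ ds. *)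
Definition Omega : 'M[R]_4 :=
  \matrix_(i, k) nth 0 (nth [::]
    [:: [:: 0; 1; 0; 0]; [:: -1; 0; 0; 0];
        [:: 0; 0; 0; 1]; [:: 0; 0; -1; 0]] i) k.

(* The coordinates of the charts of both atlases are lifts of p, q, r, s, and
   change by translations and by r |-> r + k s, which preserve [Omega]. *)
Definition Mform : form2 R M 4 := fun _ _ => Omega.
Definition Xform : form2 R X 4 := fun _ _ => Omega.

Definition plane_act (n : 'M[R[i]]_5) (x : R * R) : R * R :=
  (x.1 + complex.Re (conjc (j R * bcoord n) * expj (x.2 + acoord n)),
   x.2 + acoord n).

Definition Mact (n : 'M[R[i]]_5) (x : M) : M := (plane_act n x.1, x.2).
Definition Mmom (x : M) : dual R := uparam x.1.1 x.1.2.

Definition Xact (n : 'M[R[i]]_5) (x : X) : X := proj (Mact n (repr x)).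
Definition Xmom (x : X) : dual R := Mmom (repr x).

(* M is symplectic, and Xform, Xact, Xmom are induced by the corresponding
   structures of M. *)
Definition X_induced : Prop :=
  [/\ symplectic_manifold Matlas Mform,
      smooth_map Matlas Xatlas proj,
      is_pullback Matlas Mform Xatlas Xform proj,
      forall n x, N n -> Xact n (proj x) = proj (Mact n x) &
      forall x, Xmom (proj x) = Mmom x].

End SpaceX.

(* Main.v *)
Require Import Defs.
From mathcomp Require Import all_boot all_order all_algebra generic_quotient.
From mathcomp Require Import complex.
From mathcomp Require Import all_classical all_reals all_analysis.
From mathcomp Require Import ring lra.

(** X is the quotient of R^4 by the discrete Heisenberg group of deck
transformations (p, q, r, s) |-> (p, q + k, r + k s + l, s + m). Each of these
is a symplectic shear, and so is, up to deck transformations, every map to be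
studied (transition maps, projections, the action of N), so that the
symplectic and hamiltonian assertions reduce to one Jacobian computation on
R^4.

Suppose X is homeomorphic to Y * S, with f : Y -> U a covering. The angle of
f, lifted to R^4, is shifted by an integer by each deck transformation; these
integers form a homomorphism c from the Heisenberg group to Z, which kills the
center since the center consists of commutators. If c g <> 0, the rotation of
U lifts to a flow on Y, hence on X and on R^4, where it commutes with the deck
group and where its time [c g] is a deck transformation h with c h = c g; but
h is central, so that c h = 0. If c = 0, the angle descends to X and
identifies Y with the plane. Then X = R^2 * S has one end, whereas the height
p : X -> R is unbounded above and below with compact level bands, a
contradiction. *)

Set Implicit Arguments.
Unset Strict Implicit.
Unset Printing Implicit Defensive.

Import Order.TTheory GRing.Theory Num.Theory numFieldNormedType.Exports.

Local Open Scope classical_set_scope.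
Local Open Scope complex_scope.
Local Open Scope ring_scope.

(** * Covering spaces *)

(** Fundamental groups enter only through lifts from contractible spaces, and every identity between
    lifts comes from their uniqueness on a connected space. Thus the lifted flow commutes with a
    deck transformation because both composites lift the same path in X and agree at time 0. Its
    time [c g] is a deck transformation because turning the angle by [c g] does not change the
    projection to Y, so that this time of the flow covers the identity of X.

    The center is made of commutators because of the shear term k s: shifting s before or after the
    shear changes r by an integer, so that the two orders of a q-shift and an s-shift differ by an
    r-shift.

    The vanishing of c is no contradiction in itself; it only makes Y a plane. Topologically X is a
    line times a compact Heisenberg nilmanifold, whence its two ends and the compact bands. Counting
    ends replaces a computation of the homology of S: S inherits connectedness from R^4, and lines
    in the plane factor go around any square. *)

Lemma connected_clopen (T : topologicalType) (A : set T) :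
  connected [set: T] -> A !=set0 -> open A -> open (~` A) -> A = setT.
Proof.
move=> cT A0 oA oAc; apply: cT => //; first by exists A; rewrite ?setTI.
by exists A; rewrite ?setTI// -openC.
Qed.

Lemma openP (T : topologicalType) (A : set T) :
  (forall x, A x -> exists B, [/\ open B, B x & B `<=` A]) -> open A.
Proof.
move=> h; rewrite openE => x Ax; have [B [oB Bx BA]] := h x Ax.
by rewrite /interior; apply: (filterS BA); exact: open_nbhs_nbhs.
Qed.

Lemma open_preimage (S T : topologicalType) (f : S -> T) (A : set T) :
  continuous f -> open A -> open (f @^-1` A).
Proof. by move=> /continuousP; apply. Qed.

Lemma comp_continuous (S T U : topologicalType) (f : S -> T) (g : T -> U) :
  continuous f -> continuous g -> continuous (g \o f).
Proof. by move=> cf cg x; apply: continuous_comp; [exact: cf|exact: cg]. Qed.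

Lemma pair_continuous_at (S T U : topologicalType) (f : S -> T) (g : S -> U)
    (x : S) : {for x, continuous f} -> {for x, continuous g} ->
  {for x, continuous (fun x => (f x, g x))}.
Proof. by move=> cf cg; apply: (cvg_pair cf cg). Qed.

Lemma pair_continuous (S T U : topologicalType) (f : S -> T) (g : S -> U) :
  continuous f -> continuous g -> continuous (fun x => (f x, g x)).
Proof.
by move=> cf cg x; apply: pair_continuous_at; [exact: cf|exact: cg].
Qed.

Lemma fst_continuous (S T : topologicalType) : continuous (@fst S T).
Proof. by move=> x; exact: cvg_fst. Qed.

Lemma snd_continuous (S T : topologicalType) : continuous (@snd S T).
Proof. by move=> x; exact: cvg_snd. Qed.

Lemma pairl_continuous (S T : topologicalType) (y : T) :
  continuous (fun x : S => (x, y)).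
Proof. by apply: pair_continuous => x; [exact: cvg_id|exact: cvg_cst]. Qed.

Lemma pairr_continuous (S T : topologicalType) (x : S) :
  continuous (fun y : T => (x, y)).
Proof. by apply: pair_continuous => y; [exact: cvg_cst|exact: cvg_id]. Qed.

Lemma near_eq_continuous (S T : topologicalType) (f g : S -> T) (x : S) :
  {near x, f =1 g} -> {for x, continuous f} -> {for x, continuous g}.
Proof.
move=> fg cf; have e := nbhs_singleton fg.
rewrite /prop_for /continuous_at -e.
by apply: cvg_trans cf; apply: near_eq_cvg.
Qed.

Lemma continuous_glue (R : realType) (T : topologicalType) (f g : R -> T)
    (a : R) : continuous f -> continuous g -> f a = g a ->
  continuous (fun t => if t <= a then f t else g t).
Proof.
move=> cf cg fga x.
have [xa|ax|->] := ltgtP x a.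
- apply: (@near_eq_continuous _ _ f); last exact: cf.
  near=> t; rewrite ifT//; apply/ltW; near: t; exact: lt_nbhsl.
- apply: (@near_eq_continuous _ _ g); last exact: cg.
  near=> t; rewrite ifF//; apply/negbTE; rewrite -ltNge.
  near: t; exact: lt_nbhsr.
- move=> U; rewrite /= lexx => nU.
  have h1 : nbhs a (f @^-1` U) by exact: cf.
  have h2 : nbhs a (g @^-1` U) by apply: cg; rewrite -fga.
  by apply: filterS (filterI h1 h2) => t [ft gt] /=; case: ifP.
Unshelve. all: by end_near. Qed.

Section Lifting.
Variables (E B : topologicalType) (p : E -> B).
Hypothesis hp : covering p.

(** [s] is continuous at each point of [V] for the topology of all of [B]; since [V] will be open,
    this agrees with continuity on the subspace and composes more easily. *)
Definition sheet (V : set B) (W : set E) (s : B -> E) :=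
  [/\ open W, {in V, continuous s}, (forall v, V v -> W (s v) /\ p (s v) = v)
    & forall w, W w -> s (p w) = w].

(** The second clause stands in for a Hausdorff assumption on [E]: distinct points of one fibre lie
    in different sheets, and these are disjoint. *)
Lemma covering_sheets (b : B) : exists V : set B, [/\ open V, V b &
  (forall e, V (p e) -> exists W s, W e /\ sheet V W s) /\
  (forall e e', V (p e) -> p e = p e' -> e != e' ->
     exists W W' : set E,
       [/\ open W, open W', W e, W' e' & W `&` W' = set0])].
Proof.
have [_ /(_ b)[V [oV Vb [J [W [oW tW eW hW]]]]]] := hp.
exists V; split=> //; split.
  move=> e Ve; have : (p @^-1` V) e by [].
  rewrite eW => -[i _ We]; have [s [cs h1 h2]] := hW i.
  exists (W i), s; split=> //; split=> //.
  by rewrite -continuous_open_subspace.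
move=> e e' Ve pe ne.
have : (p @^-1` V) e by []; rewrite eW => -[i _ We].
have : (p @^-1` V) e' by rewrite /= -pe.
rewrite eW => -[i' _ We']; exists (W i), (W i'); split=> //.
apply: contrapT => /eqP/set0P h.
have ii := tW i i' I I h; subst i'.
have [s [cs h1 h2]] := hW i.
by move/eqP: ne; apply; rewrite -(h2 _ We) -(h2 _ We') pe.
Qed.

Lemma covering_continuous : continuous p.
Proof. by case: hp. Qed.

(** The set where two lifts agree is open because [p] is injective on a sheet, and its complement is
    open because distinct points of a fibre have disjoint sheets. *)
Lemma lift_unique (Z : topologicalType) (g h : Z -> E) (z0 : Z) :
  connected [set: Z] -> continuous g -> continuous h ->
  (forall z, p (g z) = p (h z)) -> g z0 = h z0 -> forall z, g z = h z.
Proof.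
move=> cZ cg ch pgh gh0 z.
suff : [set z | g z = h z] = setT by move/seteqP => [_ /(_ z I)].
apply: connected_clopen => //; first by exists z0.
- apply: openP => x /= gh; have [V [oV Vb [+ _]]] := covering_sheets (p (g x)).
  move=> /(_ _ Vb)[W [s [We [oW cs h1 h2]]]].
  exists (g @^-1` W `&` h @^-1` W); split.
  + by apply: openI; exact: open_preimage.
  + by split=> //=; rewrite -gh.
  + by move=> y [/= gy hy]; rewrite -(h2 _ gy) -(h2 _ hy) pgh.
- apply: openP => x /= /eqP gh.
  have [V [oV Vb [_ hs]]] := covering_sheets (p (g x)).
  have [W [W' [oW oW' We We' WW]]] := hs _ _ Vb (pgh x) gh.
  exists (g @^-1` W `&` h @^-1` W'); split=> //.
  + by apply: openI; exact: open_preimage.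
  + move=> y [/= gy hy] e; have : (W `&` W') (g y) by split=> //; rewrite e.
    by rewrite WW.
Qed.

End Lifting.

(** * Lifting of paths *)

Section PathLifting.
Variable R : realType.

Lemma connectedR : connected [set: R].
Proof. by apply/connected_intervalP => x y _ _ z _. Qed.

(** For [a <= b], the retraction of the line onto [[a, b]]. It lets a path on an interval be a total
    continuous map on [R]. *)
Definition clip (a b t : R) : R := Num.max a (Num.min t b).

Lemma clip_continuous a b : continuous (clip a b).
Proof.
move=> x; apply: (@continuous_max _ _ (cst a) (fun t => Num.min t b)).
  exact: cst_continuous.
by apply: (@continuous_min _ _ id (cst b)) => //; exact: cst_continuous.
Qed.

Lemma clip_itv a b t : a <= b -> a <= clip a b t <= b.
Proof. by move=> ab; rewrite /clip le_max lexx ge_max ab ge_min lexx orbT. Qed.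

Lemma clip_id a b t : a <= t <= b -> clip a b t = t.
Proof. by move=> /andP[a_t tb]; rewrite /clip min_l// max_r. Qed.

Variables (E B : topologicalType) (p : E -> B).
Hypothesis hp : covering p.

Lemma path_lift_unique (e e' : R -> E) (a b t0 : R) :
  continuous e -> continuous e' -> a <= t0 <= b ->
  (forall t, a <= t <= b -> p (e t) = p (e' t)) -> e t0 = e' t0 ->
  forall t, a <= t <= b -> e t = e' t.
Proof.
move=> ce ce' abt0 pe ee t abt.
have ab : a <= b by case/andP: abt => /le_trans; apply.
rewrite -(clip_id abt).
apply: (@lift_unique _ _ _ hp R (e \o clip a b) (e' \o clip a b) t0) => //=.
- exact: connectedR.
- by apply: comp_continuous => //; exact: clip_continuous.
- by apply: comp_continuous => //; exact: clip_continuous.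
- by move=> x; apply: pe; exact: clip_itv.
- by rewrite clip_id.
Qed.

(** The times up to which a lift exists form a clopen subset of the line; connectedness replaces the
    usual subdivision of [[0, 1]]. *)
Lemma path_lift (g : R -> B) (e0 : E) : continuous g -> p e0 = g 0 ->
  exists e : R -> E, [/\ continuous e, e 0 = e0 &
    forall t, 0 <= t <= 1 -> p (e t) = g t].
Proof.
move=> cg pe0.
pose L T := exists e : R -> E, [/\ continuous e, e 0 = e0 &
    forall t, 0 <= t <= T -> p (e t) = g t].
suff : [set T | L T] = setT by move/seteqP => [_ /(_ 1 I)].
have Lw s t : s <= t -> L t -> L s.
  move=> st [e [ce e00 he]]; exists e; split=> // r /andP[r0 rs].
  by apply: he; rewrite r0 (le_trans rs).
have L0 : L 0.
  exists (cst e0); split => [x|//|t]; first exact: cst_continuous.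
  by rewrite -eq_le => /eqP <-.
(* Near [T] the path stays in one evenly covered set, so a lift up to [t1] is continued to [t2] by a
   local section, glued at [t1]. Having the same [d] for all [t1], [t2] near [T] gives both openness
   and closedness below. *)
have Lext (T : R) : exists2 d : R, 0 < d & forall t1 t2 : R, 0 <= t1 -> t1 <= t2 ->
    T - d < t1 -> t2 < T + d -> L t1 -> L t2.
  have [V [oV Vb [hV _]]] := covering_sheets hp (g T).
  have : nbhs T (g @^-1` V) by apply: cg; exact: open_nbhs_nbhs.
  move=> /nbhs_ballP[d /= d0 hd]; exists d => // t1 t2 t10 t12 t1d t2d.
  have gV t : t1 <= t <= t2 -> V (g t).
    move=> /andP[tt1 tt2]; apply: hd; rewrite /ball/= ltr_norml; lra.
  move=> [e [ce e00 he]].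
  have et1 : p (e t1) = g t1 by apply: he; rewrite t10 lexx.
  have := gV t1; rewrite lexx t12 -et1 => /(_ isT) /hV [W [s [We [oW cs h1 h2]]]].
  exists (fun t => if t <= t1 then e t else s (g (clip t1 t2 t))); split.
  - apply: (@continuous_glue _ _ e (s \o (g \o clip t1 t2))) => //.
      move=> x; apply: continuous_comp.
        exact: (comp_continuous (@clip_continuous t1 t2) cg).
      apply: cs; rewrite inE; apply: gV; exact: clip_itv.
    by rewrite /= clip_id ?lexx// -et1 h2.
  - by rewrite t10.
  - move=> t /andP[t0 tt2]; case: ifPn => [tt1|]; first by apply: he; rewrite t0.
    rewrite -ltNge => /ltW tt1; rewrite clip_id ?tt1//.
    by case: (h1 (g t)) => //; apply: gV; rewrite tt1.
apply: connected_clopen; first exact: connectedR.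
- by exists 0.
- apply: openP => T /= LT; have [T0|T0] := ltP T 0.
    exists `]-oo, 0[%classic; split; [exact: interval_open| |]; rewrite /= ?in_itv//=.
    by move=> t; rewrite /= in_itv/= => /ltW /Lw; apply.
  have [d d0 hd] := Lext T.
  exists (ball T d); split; [exact: ball_open|exact: ballxx|].
  move=> t; rewrite -ball_normE/= ltr_norml => td.
  have [tT|tT] := leP t T; first exact: Lw LT.
  by apply: (hd T) => //; lra.
- apply: openP => T /= LT; have [T0|T0] := ltP 0 T; last by have := Lw _ _ T0 L0.
  have [d d0 hd] := Lext T.
  exists (ball T d `&` `]0, +oo[%classic); split.
  + by apply: openI; [exact: ball_open|exact: interval_open].
  + by split; [exact: ballxx|rewrite /= in_itv/= T0].
  move=> t [+ ] /=; rewrite -ball_normE/= ltr_norml in_itv/= andbT => td t0 Lt.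
  have [tT|tT] := leP T t; first exact: LT (Lw _ _ tT Lt).
  by apply: LT; apply: (hd t) => //; lra.
Qed.

End PathLifting.

(** * Lifting of homotopies *)

Section HomotopyLifting.
Variables (R : realType) (E B : topologicalType) (p : E -> B).
Hypothesis hp : covering p.

(** The lift is chosen path by path, without regard to [z]; the content is its joint continuity,
    which uniqueness of path lifts forces. Time is clipped to [[0, 1]], where [path_lift] controls
    the lift. *)
Lemma homotopy_lift (Z : topologicalType) (F : Z * R -> B) (F0 : Z -> E) :
  continuous F -> continuous F0 -> (forall z, p (F0 z) = F (z, 0)) ->
  exists G : Z * R -> E, [/\ continuous G, forall z, G (z, 0) = F0 z &
    forall z t, p (G (z, t)) = F (z, clip 0 1 t)].
Proof.
move=> cF cF0 pF0.
have cFz z : continuous (fun t : R => F (z, t)).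
  exact: (comp_continuous (@pairr_continuous Z R z) cF).
pose e z := sval (cid (path_lift hp (cFz z) (pF0 z))).
have he z : [/\ continuous (e z), e z 0 = F0 z &
    forall t, 0 <= t <= 1 -> p (e z t) = F (z, t)].
  by rewrite /e; case: cid.
pose k := @clip R 0 1.
have k01 t : 0 <= k t <= 1 by exact: clip_itv.
have ck : continuous k by exact: clip_continuous.
pose G (zt : Z * R) := e zt.1 (k zt.2).
have pG z t : p (G (z, t)) = F (z, k t) by have [_ _ ->] := he z.
have cGz z : continuous (fun t => G (z, t)).
  by have [ce _ _] := he z; exact: (comp_continuous ck ce).
have cFk : continuous (fun zt : Z * R => F (zt.1, k zt.2)).
  apply: (comp_continuous (pair_continuous (@fst_continuous Z R) _) cF).
  exact: (comp_continuous (@snd_continuous Z R) ck).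
(* Continuity in [z] propagates from one time [t1] to all times in a ball on
   which [F] stays in an evenly covered set. *)
have loc z0 t0 : exists N d, [/\ open N, N z0, 0 < d & forall t1 N1,
    ball t0 d t1 -> open N1 -> N1 z0 ->
    (forall z, N1 z -> {for z, continuous (fun z => G (z, t1))}) ->
    exists N2, [/\ open N2, N2 z0, N2 `<=` N1 &
      forall z t, N2 z -> ball t0 d t -> {for (z, t), continuous G}]].
  have [V [oV Vb [hV _]]] := covering_sheets hp (F (z0, k t0)).
  have := cFk (z0, t0) V (open_nbhs_nbhs (conj oV Vb)).
  move=> -[[N I] [/= nN /nbhs_ballP[d /= d0 dI]] NIV].
  move: nN; rewrite nbhsE => -[N' [oN' N'z] N'N].
  exists N', d; split=> // t1 N1 bt1 oN1 N1z cG1.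
  have FV z t : N' z -> ball t0 d t -> V (F (z, k t)).
    by move=> zN bt; apply: (NIV (z, t)); split; [exact: N'N|exact: dI].
  have := FV z0 t1 N'z bt1; rewrite -pG => /hV[W [s [We [oW cs h1 h2]]]].
  pose N2 := N' `&` (N1 `&` [set z | W (G (z, t1))]).
  have oN2 : open N2.
    apply: openI => //; apply: openP => z [N1y Wz].
    exists (N1 `&` ((fun z => G (z, t1)) @^-1` W)°); split.
    + by apply: openI => //; exact: open_interior.
    + split=> //; apply: (cG1 z N1y); exact: open_nbhs_nbhs.
    + by move=> y [N1y' /interior_subset].
  exists N2; split=> //.
    by move=> z [_ []].
  (* Both sides lift the same path on the segment between [t1] and [t], which stays in the ball, and
     they agree at [t1] because [G (z, t1)] lies in the sheet [W]. *)
  have GE z t : N2 z -> ball t0 d t -> s (F (z, k t)) = G (z, t).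
    move=> [zN' [zN1 zW]] bt.
    pose a := Num.min t t1; pose b := Num.max t t1.
    have ab : a <= b by rewrite /a /b ge_min le_max lexx.
    have abt : a <= t <= b by rewrite /a /b ge_min le_max lexx.
    have abt1 : a <= t1 <= b by rewrite /a /b ge_min le_max lexx !orbT.
    have bab u : a <= u <= b -> ball t0 d u.
      move: bt bt1; rewrite -ball_normE/= /a /b ge_min le_max !ltr_norml.
      by move=> /andP[? ?] /andP[? ?] /andP[/orP[?|?] /orP[?|?]]; lra.
    rewrite -{1}(clip_id abt).
    apply: (@path_lift_unique R E B p hp (fun u => s (F (z, k (clip a b u))))
      (fun u => G (z, u)) a b t1) => //.
    + move=> u; apply: (@continuous_comp _ _ _ (fun u => F (z, k (clip a b u))) s).
        exact: (comp_continuous (@clip_continuous R a b)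
          (comp_continuous ck (cFz z))).
      by apply: cs; rewrite inE; apply: FV => //; apply: bab; exact: clip_itv.
    + move=> u abu; rewrite clip_id// pG.
      by case: (h1 (F (z, k u))) => //; apply: FV => //; exact: bab.
    + by rewrite clip_id// -pG h2.
  move=> z t zN2 bt.
  have zN' : N' z by case: zN2.
  apply: (@near_eq_continuous _ _ (fun zt => s (F (zt.1, k zt.2)))); last first.
    apply: (@continuous_comp _ _ _ (fun zt : Z * R => F (zt.1, k zt.2)) s).
      exact: cFk.
    by apply: cs; rewrite inE; apply: FV.
  have : nbhs (z, t) (N2 `*` ball t0 d).
    exists (N2, ball t0 d) => //=; split; last first.
      by apply: open_nbhs_nbhs; split => //; exact: ball_open.
    exact: open_nbhs_nbhs.
  by apply: filterS => -[z' t'] [/= zN bt']; exact: GE.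
exists G; split; last by move=> z t; exact: pG.
- move=> [z0 t0].
  (* By [loc], the truth of [P] is constant on small balls of times, so it spreads from time 0,
     where [G] is the given [F0], to the whole line. *)
  pose P t := exists N, [/\ open N, N z0 &
    forall z, N z -> {for z, continuous (fun z => G (z, t))}].
  have Gt z t : {for (z, t), continuous G} ->
      {for z, continuous (fun z => G (z, t))}.
    move=> cG; apply: (@continuous_comp _ _ _ (fun z => (z, t)) G) => //.
    exact: pairl_continuous.
  have PP t : exists2 d, 0 < d & forall t1 t2, ball t d t1 -> ball t d t2 ->
      P t1 -> P t2.
    have [N [d [oN Nz d0 h]]] := loc z0 t; exists d => // t1 t2 b1 b2 [N1 [oN1 N1z c1]].
    have [N2 [oN2 N2z N21 c2]] := h _ _ b1 oN1 N1z c1.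
    by exists N2; split=> // z zN2; apply: Gt; exact: c2.
  have PT : [set t | P t] = setT.
    apply: connected_clopen; first exact: connectedR.
    - exists 0, setT; split=> //; first exact: openT.
      move=> z _; have -> : (fun z => G (z, 0)) = F0; last exact: cF0.
      apply/funext => y; rewrite /G /= /k clip_id ?lexx ?ler01//.
      by case: (he y).
    - apply: openP => t Pt; have [d d0 h] := PP t.
      exists (ball t d); split; [exact: ball_open|exact: ballxx|].
      by move=> u bu; apply: (h t) => //; exact: ballxx.
    - apply: openP => t Pt; have [d d0 h] := PP t.
      exists (ball t d); split; [exact: ball_open|exact: ballxx|].
      by move=> u bu Pu; apply: Pt; apply: (h u) => //; exact: ballxx.
  have [N1 [oN1 N1z c1]] : P t0 by have : [set t | P t] t0 by rewrite PT.
  have [N [d [oN Nz d0 h]]] := loc z0 t0.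
  have [N2 [oN2 N2z N21 c2]] := h t0 N1 (ballxx _ d0) oN1 N1z c1.
  by apply: c2 => //; exact: ballxx.
- by move=> z; rewrite /G /= /k clip_id ?lexx ?ler01//; case: (he z).
Qed.

(** The contraction is viewed as a homotopy from the constant map to [g], lifted from the constant
    [e0] and read at time 1. Since the contraction fixes [z0], the lift over [z0] never moves,
    whence [h z0 = e0]. *)
Lemma contractible_lift (Z : topologicalType) (c : Z * R -> Z) (z0 : Z)
    (g : Z -> B) (e0 : E) :
  continuous c -> (forall z, c (z, 0) = z0) -> (forall z, c (z, 1) = z) ->
  (forall t, c (z0, t) = z0) -> continuous g -> p e0 = g z0 ->
  exists h : Z -> E, [/\ continuous h, h z0 = e0 & forall z, p (h z) = g z].
Proof.
move=> cc c0 c1 ct cg pe0.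
have [z|G [cG G0 pG]] := @homotopy_lift Z (g \o c) (cst e0)
  (comp_continuous cc cg) (@cst_continuous Z E e0); first by rewrite /= c0.
exists (fun z => G (z, 1)); split.
- exact: (comp_continuous (@pairl_continuous Z R 1) cG).
- apply: (@lift_unique _ _ _ hp R (fun t => G (z0, t)) (cst e0) 0) => //.
  + exact: connectedR.
  + exact: (comp_continuous (@pairr_continuous Z R z0) cG).
  + exact: cst_continuous.
  + by move=> t; rewrite pG /= ct.
- by move=> z; rewrite pG /= clip_id ?lexx ?ler01// c1.
Qed.

End HomotopyLifting.

(** * Quotients by open maps *)

Section OpenQuotient.
Variables (E B : topologicalType) (p : E -> B).
Hypotheses (cp : continuous p) (op : forall A, open A -> open (p @` A)).

Lemma local_section (D : set E) (x0 : E) : open D ->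
  (forall x y, D x -> D y -> p x = p y -> x = y) ->
  exists s : B -> E, {in p @` D, continuous s} /\ forall x, D x -> s (p x) = x.
Proof.
move=> oD injD; pose s b := xget x0 [set y | D y /\ p y = b].
have sK x : D x -> s (p x) = x.
  move=> Dx; rewrite /s; case: xgetP => [y -> [Dy pyx]|/(_ x)[]//].
  exact: injD.
exists s; split=> // b; rewrite inE => -[x Dx <-{b}] U; rewrite sK//.
rewrite nbhsE => -[V [oV Vx] VU].
apply: (@filterS _ _ _ (p @` (V `&` D))) => [_ [y [Vy Dy] <-]|].
  by rewrite /= sK//; exact: VU.
by apply: open_nbhs_nbhs; split; [apply: op; exact: openI|exists x].
Qed.

Hypothesis surjp : forall b, exists x, p x = b.

(** The sheets over the image of [D] are its translates. The last hypothesis makes them disjoint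
    and, with [T j0] the identity, makes [p] injective on [D]. *)
Lemma deck_covering (J : Type) (T : J -> E -> E) (j0 : J) :
  (forall x, T j0 x = x) ->
  (forall i, exists T', [/\ continuous (T i), continuous T', cancel (T i) T' &
     cancel T' (T i)]) ->
  (forall x y, p x = p y <-> exists i, y = T i x) ->
  (forall x, exists D : set E, [/\ open D, D x &
     forall i k y z, D y -> D z -> T i y = T k z -> i = k]) ->
  covering p.
Proof.
move=> T0 hT pE hD; split=> // b; have [x px] := surjp b.
have [D [oD Dx injD]] := hD x.
have pT i y : p (T i y) = p y by apply/esym/pE; exists i.
have [s [cs sK]] : exists s : B -> E,
    {in p @` D, continuous s} /\ forall x, D x -> s (p x) = x.
  apply: local_section => // y z Dy Dz /pE[i zy].
  by rewrite zy -(injD j0 i z y) ?T0.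
have opD : open (p @` D) by exact: op.
exists (p @` D); split => //; first by exists x.
exists J, (fun i => T i @` D); split.
- move=> i; have [T' [cT cT' TK T'K]] := hT i.
  rewrite (_ : T i @` D = T' @^-1` D); first exact: open_preimage.
  apply/seteqP; split=> [_ [y Dy <-]|y Dy] /=; first by rewrite TK.
  by exists (T' y).
- by move=> i k _ _ [y [[z Dz <-] [z' Dz' /esym/injD]]]; exact.
- apply/seteqP; split=> [y [z Dz /pE[i yz]]|y [i _ [z Dz <-]]].
    by exists i => //; exists z.
  by exists z => //; rewrite pT.
- move=> i; have [T' [cT cT' TK T'K]] := hT i; exists (T i \o s); split.
  + rewrite continuous_open_subspace// => b' pDb'.
    by apply: continuous_comp; [exact: cs|exact: cT].
  + by move=> _ [y Dy <-] /=; rewrite sK// pT; split=> //; exists y.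
  + by move=> _ [y Dy <-] /=; rewrite pT sK.
Qed.

Lemma open_quotient_hausdorff :
  closed [set xy : E * E | p xy.1 = p xy.2] -> hausdorff_space B.
Proof.
move=> cK; rewrite open_hausdorff => b b' bb'.
have [x px] := surjp b; have [x' px'] := surjp b'.
have : nbhs (x, x') (~` [set xy : E * E | p xy.1 = p xy.2]).
  apply: open_nbhs_nbhs; split; first by rewrite openC.
  by move=> /= e; move: bb'; rewrite -px -px' e eqxx.
move=> [[N N'] [/= ]]; rewrite !nbhsE => -[U [oU Ux] UN] [U' [oU' Ux'] UN'] NN.
exists (p @` U, p @` U'); first by rewrite !inE; split; [exists x|exists x'].
split; [exact: op|exact: op|].
apply/eqP/seteqP; split=> // _ [[y Uy <-] [y' Uy' pyy]].
by apply: (NN (y, y')) => /=; [split; [exact: UN|exact: UN']|].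
Qed.

Lemma open_quotient_second_countable :
  @second_countable E -> @second_countable B.
Proof.
move=> [A cA [oA bA]]; exists ((fun V : set E => p @` V) @` A).
  exact: (sub_countable (card_image_le _ _)).
split=> [_ [V AV <-]|b U]; first by apply: op; exact: oA.
have [x <-] := surjp b => /cp /bA[V [AV Vx] VU].
by exists (p @` V); [split; [exists V|exists x]|move=> _ [y /VU ? <-]].
Qed.

End OpenQuotient.

Lemma row_continuous_at (R : realType) (T : topologicalType) n
    (f : T -> 'rV[R]_n) (x : T) :
  (forall i, {for x, continuous (fun y => f y 0 i)}) -> {for x, continuous f}.
Proof.
move=> cf; apply/cvg_ballP => e e0.
have : \forall y \near x, forall j, ball (f x 0 j) e (f y 0 j).
  apply: filter_forall => j.
  by have /cvg_ballP/(_ e e0) := cf j.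
by apply: filterS => y fy; split=> // i j; rewrite ord1.
Qed.

Lemma row_continuous (R : realType) (T : topologicalType) n (f : T -> 'rV[R]_n) :
  (forall i, continuous (fun y => f y 0 i)) -> continuous f.
Proof. by move=> cf x; apply: row_continuous_at => i; exact: cf. Qed.

Lemma second_countable_row (R : realType) n : @second_countable 'rV[R]_n.
Proof.
pose b (x : 'rV[rat]_n * nat) : set 'rV[R]_n :=
  ball (map_mx ratr x.1 : 'rV[R]_n) (x.2.+1%:R^-1 : R).
exists (range b); first exact: (sub_countable (card_image_le _ _)).
split=> [_ [x _ <-]|x U]; first exact: ball_open.
move=> /nbhs_ballP[e /= e0 eU].
have [k ke] : exists k : nat, k.+1%:R^-1 < e / 2 :> R.
  exists (Num.truncn (e / 2)^-1).
  rewrite invf_plt ?posrE ?divr_gt0 ?ltr0Sn//.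
  exact: truncnS_gt.
have hq i : exists q : rat, ball (ratr q : R) (k.+1%:R^-1 : R) (x 0 i).
  have [q] := @rat_in_itvoo R (x 0 i - k.+1%:R^-1) (x 0 i + k.+1%:R^-1)
    ltac:(by rewrite ltrBlDr -addrA ltrDl addr_gt0// invr_gt0 ltr0Sn).
  rewrite in_itv/= => /andP[q1 q2]; exists q.
  by rewrite -ball_normE/= ltr_distl q1 q2.
pose q := \row_i sval (cid (hq i)).
have bx : b (q, k) x.
  by split=> // i j; rewrite !mxE ord1; case: cid.
exists (b (q, k)) => /=; first by split=> //; exists (q, k).
move=> y /= bq; apply: eU; rewrite [e]splitr.
apply: (ball_triangle (y := (map_mx ratr q : 'rV[R]_n))).
  by apply: (le_ball (ltW ke)); exact: ball_sym.
exact: (le_ball (ltW ke)).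
Qed.

(** * The exponential of the circle *)

Section ComplexContinuity.
Variable R : realType.

Lemma complex_norm_lt (a b e : R) : `|a| < e / 2 -> `|b| < e / 2 ->
  `|Complex a b : R[i]| < e%:C.
Proof.
move=> ae be; have e0 : 0 < e by have := normr_ge0 a; lra.
rewrite normc_def ltcR /= -[ltRHS](ger0_norm (ltW e0)) -sqrtr_sqr.
rewrite ltr_sqrt ?exprn_gt0//.
rewrite -[a ^+ 2]real_normK ?num_real// -[b ^+ 2]real_normK ?num_real//.
have := normr_ge0 a; have := normr_ge0 b; nra.
Qed.

Lemma Complex_continuous_at (T : topologicalType) (f g : T -> R) (x : T) :
  {for x, continuous f} -> {for x, continuous g} ->
  {for x, continuous (fun y => Complex (f y) (g y) : C R)}.
Proof.
move=> cf cg; apply/cvgrPdist_lt => -[e i] /=; rewrite ltcE/= => /andP[/eqP-> e0].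
have e20 : 0 < e / 2 by rewrite divr_gt0.
have /cvgrPdist_lt/(_ _ e20) hf := cf; have /cvgrPdist_lt/(_ _ e20) hg := cg.
by apply: filterS (filterI hf hg) => y [fy gy]; exact: complex_norm_lt.
Qed.

Lemma cos2pi_continuous : continuous (fun t : R => cos (pi *+ 2 * t)).
Proof.
apply: (@comp_continuous _ _ _ (fun t : R => pi *+ 2 * t) cos).
  exact: mulrl_continuous.
exact: continuous_cos.
Qed.

Lemma sin2pi_continuous : continuous (fun t : R => sin (pi *+ 2 * t)).
Proof.
apply: (@comp_continuous _ _ _ (fun t : R => pi *+ 2 * t) sin).
  exact: mulrl_continuous.
exact: continuous_sin.
Qed.

Lemma expj_continuous : continuous (@expj R).
Proof.
move=> t; apply: Complex_continuous_at.
  exact: cos2pi_continuous.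
exact: sin2pi_continuous.
Qed.

Lemma expj_int (k : int) : expj (k%:~R : R) = 1.
Proof.
have e1 : expj (1 : R) = 1 by rewrite /expj mulr1 cos2pi sin2pi.
by rewrite -[X in expj X]mulr1 expjM e1 exp1rz.
Qed.

Lemma twopi_itv (t : R) : 0 <= t <= 1 / 2 -> (pi *+ 2 * t : R) \in `[0, pi].
Proof.
move=> /andP[t0 t1]; have p0 := pi_gt0 R.
by rewrite in_itv/= -mulr_natr; apply/andP; split; nra.
Qed.

Lemma cos2pi_lt (t e : R) : 0 < e -> e <= 1 / 2 -> `|t| <= 1 / 2 ->
  cos (pi *+ 2 * e) < cos (pi *+ 2 * t) -> `|t| < e.
Proof.
move=> e0 e1 t1; have p0 := pi_gt0 R.
rewrite -[cos (_ * t)]cos_norm normrM (ger0_norm (_ : 0 <= pi *+ 2)); last first.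
  by rewrite mulrn_wge0// ltW.
rewrite ltr_cos.
- by rewrite ltr_pM2l// mulrn_wgt0.
- by apply: twopi_itv; rewrite normr_ge0.
- by apply: twopi_itv; rewrite ltW.
Qed.

Lemma near_int (t : R) : exists k : int, `|t - k%:~R| <= 1 / 2.
Proof.
exists (Num.floor (t + 1 / 2)).
have := floor_le_tmp (t + 1 / 2); have := floorD1_gt (t + 1 / 2).
rewrite intrD ler_norml => ? ?; lra.
Qed.

Lemma expjB_int (t : R) (k : int) : expj (t - k%:~R) = expj t.
Proof. by rewrite -intrN expjD expj_int mulr1. Qed.

Lemma cos2piB_int (t : R) (k : int) :
  cos (pi *+ 2 * (t - k%:~R)) = cos (pi *+ 2 * t).
Proof. by have [] := expjB_int t k. Qed.

Lemma expj_eq1 (t : R) : expj t = 1 -> exists k : int, t = k%:~R.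
Proof.
move=> et; have [k tk] := near_int t; exists k; have p0 := pi_gt0 R.
have := expjB_int t k; rewrite et => -[c1 _].
apply/eqP; rewrite -subr_eq0 -normr_eq0.
suff : pi *+ 2 * `|t - k%:~R| = 0.
  by move/eqP; rewrite mulf_eq0 mulrn_eq0/= gt_eqF.
apply: cos_inj.
- by apply: twopi_itv; rewrite normr_ge0.
- by rewrite in_itv/= lexx ltW.
- rewrite cos0; apply: etrans c1.
  rewrite -[RHS]cos_norm normrM (ger0_norm (_ : 0 <= pi *+ 2))//.
  by rewrite mulrn_wge0// ltW.
Qed.

Lemma expj_eqP (s t : R) : expj s = expj t <-> exists k : int, t = s + k%:~R.
Proof.
split=> [st|[k ->]]; last by rewrite expjD expj_int mulr1.
have /expj_eq1[k tk] : expj (t - s) = 1.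
  by rewrite expjD -st -expjD subrr expj0.
by exists k; rewrite -tk addrC subrK.
Qed.

(** The real part of [expj (t - s)] is a cosine. Once [t - s] is reduced to absolute value at most
    1/2, where cosine decreases with the absolute value, a real part close to 1 bounds the distance.
    Capping [m] at 1/2 keeps its angle in the same half period. *)
Lemma expj_open (s e : R) : 0 < e ->
  exists2 d : R[i], 0 < d & forall t, `|expj t - expj s| < d ->
    exists k : int, `|t + k%:~R - s| < e.
Proof.
move=> e0; pose m := Num.min e (1 / 2).
have [m0 m1 me] : [/\ 0 < m, m <= 1 / 2 & m <= e].
  by rewrite /m lt_min e0 !ge_min !lexx orbT divr_gt0.
have d0 : 0 < 1 - cos (pi *+ 2 * m).
  have p0 := pi_gt0 R; rewrite subr_gt0 -cos0 ltr_cos.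
  - by rewrite mulr_gt0// mulrn_wgt0.
  - by rewrite in_itv/= lexx ltW.
  - by apply: twopi_itv; rewrite ltW.
exists (1 - cos (pi *+ 2 * m))%:C; first by rewrite ltcR.
move=> t ts.
have [k tk] := near_int (t - s); exists (- k).
rewrite intrN addrAC; apply: lt_le_trans me.
apply: cos2pi_lt => //; rewrite cos2piB_int -subr_gt0.
have : `|expj (t - s) - 1 : R[i]| < (1 - cos (pi *+ 2 * m))%:C.
  rewrite -(expj0 R) -(subrr s) !expjD -mulrBl normrM.
  suff -> : `|expj (- s) : R[i]| = 1 by rewrite mulr1.
  by rewrite normc_def /= cos2Dsin2 sqrtr1.
have := normc_ge_Re (expj (t - s) - 1) => /le_lt_trans h /h.
rewrite ltcR /= ltr_norml; lra.
Qed.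

End ComplexContinuity.

(** * Parametrizations of the orbit, of the torus and of X *)

Section Parametrizations.
Variable R : realType.

Lemma open_map_nbhs (E B : topologicalType) (p : E -> B) :
  (forall x A, nbhs x A -> nbhs (p x) (p @` A)) ->
  forall A, open A -> open (p @` A).
Proof.
move=> h A oA; rewrite openE => _ [x Ax <-].
by apply: h; exact: open_nbhs_nbhs.
Qed.

Lemma nbhs_setX (S T : topologicalType) (x : S) (y : T) (A : set S) (B : set T) :
  nbhs x A -> nbhs y B -> nbhs (x, y) (A `*` B).
Proof. by move=> nA nB; exists (A, B). Qed.

Lemma nbhs_val (T : topologicalType) (A : set T) (x : A) (N : set T) :
  nbhs (val x) N -> nbhs x (fun v : A => N (val v)).
Proof. by rewrite -set_valE => nN; exact: (@initial_continuous A T set_val x N nN). Qed.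

Lemma set_type_continuous (S T : topologicalType) (A : set T) (f : S -> A) :
  continuous (fun x => val (f x)) -> continuous f.
Proof. by rewrite -set_valE => cf; apply: continuous_comp_initial. Qed.

Lemma U_subproof (x : R * R) : uparam x.1 x.2 \in @U R.
Proof. by rewrite inE; exists x.1, x.2. Qed.

Definition ucov (x : R * R) : @U R := SigSub (U_subproof x).

Lemma ucov_surj (v : @U R) : exists x, ucov x = v.
Proof.
case: v => v vU; have [p [q e]] := set_mem vU.
by exists (p, q); apply/val_inj.
Qed.

Lemma uparam_inj (p q p' q' : R) : uparam p q = uparam p' q' <->
  p = p' /\ exists k : int, q' = q + k%:~R.
Proof.
split=> [[-> c s]|[-> /expj_eqP qq]]; last by rewrite /uparam qq.
by split=> //; apply/expj_eqP; rewrite /expj c s.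
Qed.

Lemma ucov_eqP (x y : R * R) :
  ucov x = ucov y <-> exists k : int, y = (x.1, x.2 + k%:~R).
Proof.
case: x y => p q [p' q']; split=> [|[k [-> ->]]].
  by move=> /(congr1 val) /uparam_inj[/= -> [k ->]]; exists k.
by apply/val_inj/uparam_inj; split=> //=; exists k.
Qed.

Lemma ucov_continuous : continuous ucov.
Proof.
apply: set_type_continuous => -[p q].
apply: pair_continuous_at; last exact: cvg_cst.
apply: pair_continuous_at; first exact: fst_continuous.
exact: (comp_continuous (@snd_continuous R R) (@expj_continuous R)).
Qed.

Lemma ucov_open (A : set (R * R)) : open A -> open (ucov @` A).
Proof.
move: A; apply: open_map_nbhs => -[p q] A [[P Q] [/= nP nQ] PQA].
have /nbhs_ballP[e /= e0 eQ] := nQ.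
have [d d0 hd] := expj_open q e0.
have nd : nbhs (expj q : C R) (ball (expj q : C R) d) by exact: nbhsx_ballx.
pose N : set (dual R) := (P `*` ball (expj q : C R) d) `*` setT.
have nN : nbhs (uparam p q) N by exact: (nbhs_setX (nbhs_setX nP nd) filterT).
have : nbhs (ucov (p, q)) (fun v : @U R => N (val v)) by exact: nbhs_val.
apply: filterS => v [[vP vd] _]; have [[p' q'] vE] := ucov_surj v.
move: vP vd; rewrite -vE /= -ball_normE /= => vP; rewrite distrC => /hd[k qk].
exists (p', q' + k%:~R); last by apply/esym/ucov_eqP; exists k.
by apply: PQA; split=> //; apply: eQ; rewrite -ball_normE/= distrC.
Qed.

Lemma torus_eqP (r s r' s' : R) : torus r s = torus r' s' <->
  (exists l : int, r' = r + l%:~R) /\ (exists m : int, s' = s + m%:~R).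
Proof.
split=> [/(congr1 val)[c s1 c' s1']|[/expj_eqP rr /expj_eqP ss]].
  by split; apply/expj_eqP; rewrite /expj; congr Complex.
by apply/val_inj => /=; rewrite rr ss.
Qed.

Lemma torus_continuous : continuous (fun x : R * R => torus x.1 x.2).
Proof.
apply: set_type_continuous => /=; apply: pair_continuous.
  exact: (comp_continuous (@fst_continuous R R) (@expj_continuous R)).
exact: (comp_continuous (@snd_continuous R R) (@expj_continuous R)).
Qed.

Lemma torus_nbhs (r s e : R) : 0 < e -> \forall v \near torus r s,
  exists r' s', [/\ v = torus r' s', ball r e r' & ball s e s'].
Proof.
move=> e0; have [d d0 hd] := expj_open r e0; have [d' d0' hd'] := expj_open s e0.
pose N := ball (expj r : C R) d `*` ball (expj s : C R) d'.
have nN : nbhs (expj r : C R, expj s : C R) N.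
  by apply: nbhs_setX; exact: nbhsx_ballx.
have : nbhs (torus r s) (fun v : @T2 R => N (val v)) by exact: nbhs_val.
apply: filterS => v; have [r' [s' ->]] := torus_surj v.
have bE (x y : C R) (f : R[i]) : ball x f y -> `|y - x| < f.
  by rewrite -ball_normE/= distrC.
move=> [/bE/hd[l rl] /bE/hd'[m sm]].
exists (r' + l%:~R), (s' + m%:~R).
by split; rewrite -?ball_normE /= 1?distrC//; apply/torus_eqP; split; [exists l|exists m].
Qed.

Definition row4 (a b c d : R) : 'rV[R]_4 := \row_i nth 0 [:: a; b; c; d] i.

Lemma row4E (a b c d : R) (x := row4 a b c d) : (x 0 (inord 0) = a) *
  (x 0 (inord 1) = b) * (x 0 (inord 2) = c) * (x 0 (inord 3) = d).
Proof. by rewrite /x /row4; do !split; rewrite mxE inordK. Qed.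

Lemma ord4_ind (P : 'I_4 -> Prop) : P (inord 0) -> P (inord 1) ->
  P (inord 2) -> P (inord 3) -> forall i, P i.
Proof.
move=> p0 p1 p2 p3 i; rewrite -(inord_val i).
by case: i => -[|[|[|[|//]]]].
Qed.

Lemma row4P (x y : 'rV[R]_4) : x 0 (inord 0) = y 0 (inord 0) ->
  x 0 (inord 1) = y 0 (inord 1) -> x 0 (inord 2) = y 0 (inord 2) ->
  x 0 (inord 3) = y 0 (inord 3) -> x = y.
Proof. by move=> *; apply/rowP; apply: ord4_ind. Qed.

(* The triples form the discrete Heisenberg group, see [deckM]. *)
Definition deck (g : int * int * int) (y : 'rV[R]_4) : 'rV[R]_4 :=
  row4 (y 0 (inord 0)) (y 0 (inord 1) + g.1.1%:~R)
    (y 0 (inord 2) + g.1.1%:~R * y 0 (inord 3) + g.1.2%:~R)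
    (y 0 (inord 3) + g.2%:~R).

Lemma deckE (k l m : int) (y : 'rV[R]_4) (z := deck (k, l, m) y) :
  (z 0 (inord 0) = y 0 (inord 0)) *
  (z 0 (inord 1) = y 0 (inord 1) + k%:~R) *
  (z 0 (inord 2) = y 0 (inord 2) + k%:~R * y 0 (inord 3) + l%:~R) *
  (z 0 (inord 3) = y 0 (inord 3) + m%:~R).
Proof. by rewrite /z /deck /= !row4E. Qed.

(** The cocycle [k' * m] appears because the second shear multiplies [k'] by the coordinate s
    already shifted by [m]. *)
Lemma deckM (k l m k' l' m' : int) (y : 'rV[R]_4) :
  deck (k', l', m') (deck (k, l, m) y) =
  deck (k + k', l + l' + k' * m, m + m') y.
Proof. by apply: row4P; rewrite !deckE ?intrD ?intrM; ring. Qed.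

Lemma deck1 (y : 'rV[R]_4) : deck (0, 0, 0) y = y.
Proof. by apply: row4P; rewrite !deckE; ring. Qed.

Lemma deck_inj (g h : int * int * int) (y : 'rV[R]_4) :
  deck g y = deck h y -> g = h.
Proof.
case: g h => -[k l] m [[k' l'] m'] e.
have := congr1 (fun z : 'rV[R]_4 => z 0 (inord 1)) e.
have := congr1 (fun z : 'rV[R]_4 => z 0 (inord 3)) e.
have := congr1 (fun z : 'rV[R]_4 => z 0 (inord 2)) e.
rewrite !deckE => e2 /addrI/intr_inj -> /addrI/intr_inj kk.
by move: e2; rewrite kk => /addrI/intr_inj ->.
Qed.

Lemma int_shift_inj (u v : R) (a b : int) :
  `|u - v| < 1 -> u + a%:~R = v + b%:~R -> a = b.
Proof.
move=> uv e1; have : `|b - a| < 1.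
  rewrite -(ltr_int R) intr_norm intrB.
  suff -> : b%:~R - a%:~R = u - v by [].
  by rewrite -[u](addrK a%:~R) e1; ring.
by rewrite -[X in _ < X]addr0 ltz1D normr_le0 subr_eq0 => /eqP->.
Qed.

(** Points of the ball differ by less than 1 in each coordinate, so coordinates q and s determine
    [k] and [m]. Equality of [m] forces [y] and [z] to have the same s; the shear terms then cancel
    and r determines [l]. *)
Lemma deck_discrete (x y z : 'rV[R]_4) (g h : int * int * int) :
  ball x (1 / 2) y -> ball x (1 / 2) z -> deck g y = deck h z -> g = h.
Proof.
case: g h => -[k l] m [[k' l'] m'] [_ xy] [_ xz] e.
have lt1 i : `|y 0 i - z 0 i| < 1.
  have := xy 0 i; have := xz 0 i; rewrite -!ball_normE /= !ltr_norml; lra.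
have := congr1 (fun z : 'rV[R]_4 => z 0 (inord 1)) e.
have := congr1 (fun z : 'rV[R]_4 => z 0 (inord 3)) e.
have := congr1 (fun z : 'rV[R]_4 => z 0 (inord 2)) e.
rewrite !deckE => e2 e3 e1.
have kk := int_shift_inj (lt1 _) e1; have mm := int_shift_inj (lt1 _) e3; subst.
have e3' := addIr _ e3; rewrite e3' in e2.
by rewrite (@int_shift_inj (y 0 (inord 2)) (z 0 (inord 2)) l l')//; lra.
Qed.

Lemma addr_continuous (T : topologicalType) (f g : T -> R) :
  continuous f -> continuous g -> continuous (fun x => f x + g x).
Proof. by move=> cf cg x; apply: continuousD; [exact: cf|exact: cg]. Qed.

Lemma mulr_continuous (T : topologicalType) (f g : T -> R) :
  continuous f -> continuous g -> continuous (fun x => f x * g x).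
Proof. by move=> cf cg x; apply: continuousM; [exact: cf|exact: cg]. Qed.

Lemma oppr_continuous (T : topologicalType) (f : T -> R) :
  continuous f -> continuous (fun x => - f x).
Proof. by move=> cf x; apply: continuousN; exact: cf. Qed.

Lemma row4_continuous (T : topologicalType) (a b c d : T -> R) :
  continuous a -> continuous b -> continuous c -> continuous d ->
  continuous (fun x => row4 (a x) (b x) (c x) (d x)).
Proof.
move=> ca cb cc cd; apply: row_continuous; apply: ord4_ind => x;
  under eq_fun do rewrite row4E; [exact: ca|exact: cb|exact: cc|exact: cd].
Qed.

Lemma deck_continuous (g : int * int * int) : continuous (deck g).
Proof.
have cc i : continuous (fun y : 'rV[R]_4 => y 0 i) by exact: coord_continuous.
have ck (k : R) : continuous (fun _ : 'rV[R]_4 => k) by exact: cst_continuous.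
apply: row4_continuous => //; do ?apply: addr_continuous => //.
exact: mulr_continuous.
Qed.

Lemma deckK (k l m : int) :
  cancel (deck (k, l, m)) (deck (- k, - l + k * m, - m)).
Proof.
move=> y; rewrite deckM -[RHS]deck1; congr (deck (_, _, _) y).
- by rewrite addrN.
- by ring.
- by rewrite addrN.
Qed.

Lemma deckVK (k l m : int) :
  cancel (deck (- k, - l + k * m, - m)) (deck (k, l, m)).
Proof.
move=> y; rewrite deckM -[RHS]deck1; congr (deck (_, _, _) y).
- by rewrite addNr.
- by ring.
- by rewrite addNr.
Qed.

Lemma Mparam_eqP (x y : 'rV[R]_4) :
  Mparam x = Mparam y <-> exists l m : int, y = deck (0, l, m) x.
Proof.
split=> [[e0 e1 c2 s2 c3 s3]|[l [m ->]]].
  have /expj_eqP[l e2] : expj (x 0 (inord 2)) = expj (y 0 (inord 2)).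
    by rewrite /expj c2 s2.
  have /expj_eqP[m e3] : expj (x 0 (inord 3)) = expj (y 0 (inord 3)).
    by rewrite /expj c3 s3.
  by exists l, m; apply: row4P; rewrite !deckE ?mul0r ?addr0.
rewrite /Mparam !deckE mul0r !addr0; congr (_, _).
by apply/torus_eqP; split; [exists l|exists m].
Qed.

Lemma Mparam_surj (x : M R) : exists y, Mparam y = x.
Proof.
case: x => -[p q] u; have [r [s ->]] := torus_surj u.
by exists (row4 p q r s); rewrite /Mparam !row4E.
Qed.

Lemma Mparam_continuous : continuous (@Mparam R).
Proof.
have cc i : continuous (fun y : 'rV[R]_4 => y 0 i) by exact: coord_continuous.
apply: pair_continuous; first exact: pair_continuous.
exact: (comp_continuous (pair_continuous (cc _) (cc _)) torus_continuous).
Qed.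

Lemma Mparam_open (A : set 'rV[R]_4) : open A -> open (@Mparam R @` A).
Proof.
move: A; apply: open_map_nbhs => y A /nbhs_ballP[e /= e0 eA].
have := nbhs_setX (nbhs_setX (nbhsx_ballx (y 0 (inord 0)) _ e0)
  (nbhsx_ballx (y 0 (inord 1)) _ e0)) (torus_nbhs (y 0 (inord 2)) (y 0 (inord 3)) e0).
apply: filterS => -[[p q] u] [[/= bp bq] [r [s [-> br bs]]]].
exists (row4 p q r s); last by rewrite /Mparam !row4E.
by apply: eA; split=> // i; rewrite (ord1 i); apply: ord4_ind; rewrite row4E.
Qed.

Definition Xparam (y : 'rV[R]_4) : X R := Defs.proj (Mparam y).

Lemma proj_eqP (x y : M R) : Defs.proj x = Defs.proj y <-> exists k, zact k x = y.
Proof.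
rewrite /Defs.proj; split=> [/eqmodP/asboolP//|h].
by apply/eqmodP/asboolP.
Qed.

Lemma zact_Mparam (k : int) (y : 'rV[R]_4) :
  zact k (Mparam y) = Mparam (deck (k, 0, 0) y).
Proof. by rewrite /Mparam zactE !deckE !addr0. Qed.

Lemma Xparam_eqP (x y : 'rV[R]_4) :
  Xparam x = Xparam y <-> exists g, y = deck g x.
Proof.
split=> [/proj_eqP[k]|[[[k l] m] ->]].
  rewrite zact_Mparam => /Mparam_eqP[l [m ->]].
  by eexists; rewrite deckM.
apply/proj_eqP; exists k; rewrite zact_Mparam; apply/Mparam_eqP.
by exists l, m; rewrite deckM; congr (deck (_, _, _) x); ring.
Qed.

Lemma Xparam_surj (x : X R) : exists y, Xparam y = x.
Proof.
have [y yx] := Mparam_surj (repr x); exists y.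
by rewrite /Xparam yx /Defs.proj reprK.
Qed.

Lemma proj_continuous : continuous (@Defs.proj R).
Proof. exact: pi_continuous. Qed.

Lemma Xparam_continuous : continuous Xparam.
Proof. exact: (comp_continuous Mparam_continuous proj_continuous). Qed.

Lemma Xparam_open (A : set 'rV[R]_4) : open A -> open (Xparam @` A).
Proof.
move=> oA.
have oE : open (@Defs.proj R @^-1` (Xparam @` A)).
  (* Openness in the quotient is openness of the saturated preimage in [M], which is the union of
     the translates of the image of [A]; [Mparam] is already known to be open. *)
  have -> : @Defs.proj R @^-1` (Xparam @` A) =
      @Mparam R @` (\bigcup_(k : int) (deck (- k, 0, 0) @^-1` A)).
    apply/seteqP; split=> [m [y Ay /proj_eqP[k <-]]|_ [y [k _ Ay] <-]].
      rewrite zact_Mparam; exists (deck (k, 0, 0) y) => //; exists k => //=.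
      by have := deckK k 0 0 y; rewrite mulr0 oppr0 addr0 => ->.
    exists (deck (- k, 0, 0) y) => //; apply/Xparam_eqP; exists (k, 0, 0).
    by have := deckVK k 0 0 y; rewrite mulr0 oppr0 addr0 => ->.
  by apply: Mparam_open; apply: bigcup_open => k _; apply: open_preimage => //;
    exact: deck_continuous.
exact: oE.
Qed.

Lemma Xparam_covering : covering Xparam.
Proof.
apply: (@deck_covering _ _ Xparam Xparam_continuous Xparam_open Xparam_surj
  _ deck (0, 0, 0) deck1).
- move=> [[k l] m]; exists (deck (- k, - l + k * m, - m)); split.
  + exact: deck_continuous.
  + exact: deck_continuous.
  + exact: deckK.
  + exact: deckVK.
- exact: Xparam_eqP.
- move=> x; exists (ball x (1 / 2)); split.
  + exact: ball_open.
  + exact: ballxx.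
  + by move=> g h y z; exact: deck_discrete.
Qed.

Lemma ucov_covering : covering ucov.
Proof.
have cT (k : int) : continuous (fun x : R * R => (x.1, x.2 + k%:~R)).
  apply: pair_continuous; first exact: fst_continuous.
  by move=> x; apply: continuousD; [exact: snd_continuous|exact: cst_continuous].
apply: (@deck_covering _ _ ucov ucov_continuous ucov_open ucov_surj
  int (fun k x => (x.1, x.2 + k%:~R)) 0).
- by case=> p q; rewrite addr0.
- move=> k; exists (fun x => (x.1, x.2 + (- k)%:~R)); split=> //.
  + by case=> p q /=; rewrite intrN addrK.
  + by case=> p q /=; rewrite intrN subrK.
- exact: ucov_eqP.
- move=> x; exists (ball x (1 / 2)); split.
  + exact: ball_open.
  + exact: ballxx.
  + move=> k l y z [_ /= xy] [_ /= xz] [_]; apply: int_shift_inj.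
    by move: xy xz; rewrite -!ball_normE /= !ltr_norml; lra.
Qed.

End Parametrizations.

(** * Maps from X to a product *)

Section Connected.
Variable R : realType.

Lemma contractible_connected (Z : topologicalType) (c : Z * R -> Z) (z0 : Z) :
  continuous c -> (forall z, c (z, 0) = z0) -> (forall z, c (z, 1) = z) ->
  connected [set: Z].
Proof.
move=> cc c0 c1.
have -> : [set: Z] = \bigcup_(z in setT) (fun t : R => c (z, t)) @` setT.
  by apply/seteqP; split=> // z _; exists z => //; exists 1.
apply: bigcup_connected => [|z _]; first by exists z0 => z _; exists 0.
apply: connected_continuous_connected; first exact: connectedR.
apply: continuous_subspaceT.
exact: (comp_continuous (@pairr_continuous Z R z) cc).
Qed.

Definition ctr_row n (x : 'rV[R]_n * R) : 'rV[R]_n := x.2 *: x.1.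

(** The centre is arbitrary because the base point will be some preimage of [f (yy 0)] under [ucov],
    which need not be the origin. *)
Definition ctr_plane (x0 : R * R) (x : R * R * R) : R * R :=
  (x0.1 + x.2 * (x.1.1 - x0.1), x0.2 + x.2 * (x.1.2 - x0.2)).

Definition ctr_rowR n (x : 'rV[R]_n * R * R) : 'rV[R]_n * R :=
  (x.2 *: x.1.1, x.2 * x.1.2).

Lemma ctr_row_continuous n : continuous (@ctr_row n).
Proof.
apply: row_continuous => i; under eq_fun do rewrite mxE.
apply: mulr_continuous; first exact: snd_continuous.
exact: (comp_continuous (@fst_continuous _ _) (@coord_continuous R 1 n 0 i)).
Qed.

Lemma ctr_plane_continuous x0 : continuous (ctr_plane x0).
Proof.
have c1 : continuous (fun x : R * R * R => x.1.1).
  exact: (comp_continuous (@fst_continuous (R * R)%type R) (@fst_continuous R R)).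
have c2 : continuous (fun x : R * R * R => x.1.2).
  exact: (comp_continuous (@fst_continuous (R * R)%type R) (@snd_continuous R R)).
have ck (k : R) : continuous (fun _ : R * R * R => k) by exact: cst_continuous.
apply: pair_continuous; apply: addr_continuous => //;
  apply: mulr_continuous; try exact: snd_continuous;
  exact: addr_continuous.
Qed.

Lemma ctr_rowR_continuous n : continuous (@ctr_rowR n).
Proof.
apply: pair_continuous.
  apply: (@comp_continuous _ _ _ (fun x : 'rV[R]_n * R * R => (x.1.1, x.2))
    (@ctr_row n)); last exact: ctr_row_continuous.
  apply: pair_continuous; last exact: snd_continuous.
  exact: (comp_continuous (@fst_continuous _ _) (@fst_continuous _ _)).
apply: mulr_continuous; first exact: snd_continuous.
exact: (comp_continuous (@fst_continuous _ _) (@snd_continuous _ _)).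
Qed.

Lemma connected_row n : connected [set: 'rV[R]_n].
Proof.
apply: (@contractible_connected _ (@ctr_row n) 0 (@ctr_row_continuous n)) => z.
  by rewrite /ctr_row scale0r.
by rewrite /ctr_row scale1r.
Qed.

Lemma connected_plane : connected [set: R * R].
Proof.
apply: (@contractible_connected _ (ctr_plane (0, 0)) (0, 0)
  (@ctr_plane_continuous (0, 0))) => -[a b]; rewrite /ctr_plane /=.
  by rewrite !mul0r addr0.
by rewrite !mul1r !subr0 !add0r.
Qed.

End Connected.

(** * The angle of a product decomposition under the deck group *)

Section NotProduct.
Variables (R : realType) (Y S : topologicalType) (f : Y -> @U R).
Variables (phi : X R -> Y * S) (psi : Y * S -> X R).
Hypotheses (hf : covering f) (cphi : continuous phi) (cpsi : continuous psi).
Hypotheses (phiK : cancel phi psi) (psiK : cancel psi phi).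

Let yy z := (phi (Xparam z)).1.
Let ss z := (phi (Xparam z)).2.

Let cyy : continuous yy.
Proof.
exact: (comp_continuous (comp_continuous (@Xparam_continuous R) cphi)
  (@fst_continuous Y S)).
Qed.

Let css : continuous ss.
Proof.
exact: (comp_continuous (comp_continuous (@Xparam_continuous R) cphi)
  (@snd_continuous Y S)).
Qed.

Let yy_deck g z : yy (deck g z) = yy z.
Proof.
rewrite /yy (_ : Xparam (deck g z) = Xparam z)//.
by apply/esym/Xparam_eqP; exists g.
Qed.

Let ss_deck g z : ss (deck g z) = ss z.
Proof.
rewrite /ss (_ : Xparam (deck g z) = Xparam z)//.
by apply/esym/Xparam_eqP; exists g.
Qed.

Lemma factor_connected : connected [set: S].
Proof.
have -> : [set: S] = ss @` setT.
  apply/seteqP; split=> // s _.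
  have [z zx] := Xparam_surj (psi (yy 0, s)).
  by exists z => //; rewrite /ss zx psiK.
apply: connected_continuous_connected; first exact: connected_row.
exact: continuous_subspaceT.
Qed.

(* [PT] lifts [f \o yy] to the universal cover of [U] and [ut] is the universal
   cover of [Y]; [c] is the action of [pi_1] on the angle. *)
Lemma product_lifts : exists (PT : 'rV[R]_4 -> R * R) (ut : R * R -> Y)
    (c : int * int * int -> int),
  [/\ continuous PT, continuous ut,
    forall z, ucov (PT z) = f (yy z), forall x, f (ut x) = ucov x &
    (forall z, ut (PT z) = yy z) /\
    (forall g z, PT (deck g z) = ((PT z).1, (PT z).2 + (c g)%:~R))].
Proof.
have [x0 ex0] := ucov_surj (f (yy 0)).
have [|||||PT [cPT PT0 fPT]] := contractible_lift (@ucov_covering R)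
  (@ctr_row_continuous R 4) (z0 := (0 : 'rV[R]_4)) (g := f \o yy) (e0 := x0).
- by move=> z; rewrite /ctr_row scale0r.
- by move=> z; rewrite /ctr_row scale1r.
- by move=> t; rewrite /ctr_row scaler0.
- exact: (comp_continuous cyy (covering_continuous hf)).
- by [].
have [|||||ut [cut ut0 fut]] := contractible_lift hf
  (@ctr_plane_continuous R x0) (z0 := x0) (g := @ucov R) (e0 := yy 0).
- by case=> a b; rewrite /ctr_plane /= !mul0r !addr0; case: (x0).
- by case=> a b; rewrite /ctr_plane /= !mul1r !subrKC.
- by move=> t; rewrite /ctr_plane /= !subrr !mulr0 !addr0; case: (x0).
- exact: ucov_continuous.
- by [].
(* Both sides lift [f \o yy] and agree at the origin. *)
have utPT z : ut (PT z) = yy z.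
  apply: (@lift_unique _ _ _ hf _ (ut \o PT) yy 0); first exact: connected_row.
  - exact: comp_continuous.
  - exact: cyy.
  - by move=> x /=; rewrite fut fPT.
  - by rewrite /= PT0 ut0.
(* The integer is read off at the origin; uniqueness of lifts makes it valid at every [z]. *)
have hc g : exists k : int, forall z, PT (deck g z) = ((PT z).1, (PT z).2 + k%:~R).
  have /ucov_eqP[k ek] : ucov (PT 0) = ucov (PT (deck g 0)).
    by rewrite !fPT /= yy_deck.
  exists k => z.
  apply: (@lift_unique _ _ _ (@ucov_covering R) _ (PT \o deck g)
    (fun z => ((PT z).1, (PT z).2 + k%:~R)) 0) => //.
  - exact: connected_row.
  - exact: (comp_continuous (@deck_continuous R g) cPT).
  - apply: pair_continuous; first exact: (comp_continuous cPT (@fst_continuous _ _)).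
    apply: addr_continuous; last exact: cst_continuous.
    exact: (comp_continuous cPT (@snd_continuous _ _)).
  - move=> x /=; rewrite fPT /= yy_deck -[f _]fPT; apply/ucov_eqP.
    by exists k.
exists PT, ut, (fun g => sval (cid (hc g))); split=> //; split=> // g z.
by case: cid => k /= ->.
Qed.

Variables (PT : 'rV[R]_4 -> R * R) (ut : R * R -> Y) (c : int * int * int -> int).
Hypotheses (cPT : continuous PT) (cut : continuous ut).
Hypotheses (fPT : forall z, ucov (PT z) = f (yy z)).
Hypotheses (fut : forall x, f (ut x) = ucov x).
Hypotheses (utPT : forall z, ut (PT z) = yy z).
Hypotheses (PT_deck : forall g z, PT (deck g z) = ((PT z).1, (PT z).2 + (c g)%:~R)).

Let rot (x : R * R) (t : R) := (x.1, x.2 + t).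

Let crot (T : topologicalType) (a : T -> R * R) (b : T -> R) :
  continuous a -> continuous b -> continuous (fun x => rot (a x) (b x)).
Proof.
move=> ca cb; apply: pair_continuous.
  exact: (comp_continuous ca (@fst_continuous _ _)).
apply: addr_continuous => //.
exact: (comp_continuous ca (@snd_continuous _ _)).
Qed.

(** Both sides lift [ucov] through [f], and they agree at [PT 0], where the rotation by [c g] is the
    effect of a deck transformation that [yy] does not see. *)
Lemma rot_period g x : ut (rot x (c g)%:~R) = ut x.
Proof.
apply: (@lift_unique _ _ _ hf _ (fun x => ut (rot x (c g)%:~R)) ut (PT 0)) => //.
- exact: connected_plane.
- apply: (@comp_continuous _ _ _ (fun x => rot x (c g)%:~R) ut) => //.
  apply: crot; [by move=> y; exact: cvg_id|exact: cst_continuous].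
- by move=> y; rewrite !fut; apply/esym/ucov_eqP; exists (c g).
- by rewrite -[rot _ _]PT_deck !utPT yy_deck.
Qed.

Lemma deck_angleM k l m k' l' m' :
  c (k + k', l + l' + k' * m, m + m') = c (k', l', m') + c (k, l, m).
Proof.
have := PT_deck (k', l', m') (deck (k, l, m) 0).
rewrite deckM !PT_deck => /(congr1 snd) /= e.
by apply: (@intr_inj R); rewrite intrD; lra.
Qed.

(** The products of [(1, 0, 0)] and [(0, 0, l)] in the two orders differ by [(0, l, 0)], while the
    values of [c] add up commutatively. *)
Lemma deck_angle_center l : c (0, l, 0) = 0.
Proof.
have := deck_angleM 0 0 l 1 0 0; have := deck_angleM 1 0 l 0 l 0.
have := deck_angleM 1 0 0 0 0 l.
rewrite !add0r !addr0 !mul0r !mul1r !addr0 => -> -> /eqP.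
by rewrite [c (1, 0, 0) + _]addrC -[X in _ == X]add0r => /eqP/addIr.
Qed.

(* The rotation of [U] lifts to [Y], hence to a flow on [X] and on ['rV_4]
   commuting with the deck group; it is periodic up to a central deck
   transformation, which does not change the angle. *)
Lemma angle_invariant g : c g = 0.
Proof.
(* This rotates the [Y]-factor of [Xparam z] by the angle [t], through the plane above [Y], and
   keeps its [S]-factor. *)
pose F (w : 'rV[R]_4 * R) := psi (ut (rot (PT w.1) w.2), ss w.1).
have cF : continuous F.
  apply: (@comp_continuous _ _ _
    (fun w => (ut (rot (PT w.1) w.2), ss w.1)) psi) => //.
  apply: pair_continuous.
    apply: (@comp_continuous _ _ _ (fun w => rot (PT w.1) w.2) ut) => //.
    apply: crot; last exact: snd_continuous.
    exact: (comp_continuous (@fst_continuous _ _) cPT).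
  exact: (comp_continuous (@fst_continuous _ _) css).
have F0 z : F (z, 0) = Xparam z.
  rewrite /F /= /rot addr0 -surjective_pairing utPT /yy /ss.
  by rewrite -surjective_pairing phiK.
have Fdeck h z t : F (deck h z, t) = F (z, t).
  rewrite /F /= ss_deck; congr (psi (_, _)).
  have -> : rot (PT (deck h z)) t = rot (rot (PT z) t) (c h)%:~R.
    by rewrite PT_deck /rot /= addrAC.
  exact: rot_period.
have Fk z : F (z, (c g)%:~R) = F (z, 0).
  by rewrite /F /= rot_period /rot addr0 -surjective_pairing.
have [|||||Ps [cPs Ps0 FPs]] := contractible_lift (@Xparam_covering R)
  (@ctr_rowR_continuous R 4) (z0 := ((0, 0) : 'rV[R]_4 * R)) (g := F) (e0 := (0 : 'rV[R]_4)).
- by case=> z t; rewrite /ctr_rowR /= scale0r mul0r.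
- by case=> z t; rewrite /ctr_rowR /= scale1r mul1r.
- by move=> t; rewrite /ctr_rowR /= scaler0 mulr0.
- by [].
- by rewrite F0.
have cPsz z : continuous (fun t => Ps (z, t)).
  exact: (comp_continuous (@pairr_continuous _ _ z) cPs).
have cPst t : continuous (fun z => Ps (z, t)).
  exact: (comp_continuous (@pairl_continuous _ _ t) cPs).
have Psz z : Ps (z, 0) = z.
  apply: (@lift_unique _ _ _ (@Xparam_covering R) _ (fun z => Ps (z, 0)) id 0) => //.
  - exact: connected_row.
  - by move=> x; exact: cvg_id.
  - by move=> x; rewrite FPs F0.
have Ps_deck h z t : Ps (deck h z, t) = deck h (Ps (z, t)).
  apply: (@lift_unique _ _ _ (@Xparam_covering R) _ (fun t => Ps (deck h z, t))
    (fun t => deck h (Ps (z, t))) 0) => //.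
  - exact: connectedR.
  - exact: (comp_continuous (cPsz z) (@deck_continuous R h)).
  - move=> u; rewrite FPs Fdeck -FPs; apply/Xparam_eqP; by exists h.
  - by rewrite !Psz.
have [h hk] : exists h, forall z, Ps (z, (c g)%:~R) = deck h z.
  have /Xparam_eqP[h hh] : Xparam 0 = Xparam (Ps (0, (c g)%:~R)).
    by rewrite FPs Fk F0.
  exists h => z.
  apply: (@lift_unique _ _ _ (@Xparam_covering R) _
    (fun z => Ps (z, (c g)%:~R)) (deck h) 0) => //.
  - exact: connected_row.
  - exact: deck_continuous.
  - by move=> x; rewrite FPs Fk F0; apply/Xparam_eqP; exists h.
(* Upstairs the flow adds exactly [t] to the angle. At time [c g] the flow is [deck h], which adds
   [c h]; hence [c h = c g]. *)
have PTPs z t : PT (Ps (z, t)) = rot (PT z) t.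
  apply: (@lift_unique _ _ _ (@ucov_covering R) _ (fun t => PT (Ps (z, t)))
    (rot (PT z)) 0).
  - exact: connectedR.
  - exact: (comp_continuous (cPsz z) cPT).
  - by apply: crot; [exact: cst_continuous|move=> x; exact: cvg_id].
  - by move=> u; rewrite fPT /yy FPs /F psiK /= fut.
  - by rewrite Psz /rot addr0 -surjective_pairing.
have hC h' (z : 'rV[R]_4) : deck h (deck h' z) = deck h' (deck h z).
  by rewrite -!hk Ps_deck.
have ch : c h = c g.
  have := PTPs 0 (c g)%:~R; rewrite hk PT_deck => /(congr1 snd) /addrI.
  exact: intr_inj.
rewrite -ch; move: h hC {hk ch} => [[k l] m] hC.
(* Commuting with [(0, 0, 1)] forces [k = 0] and commuting with [(1, 0, 0)] forces [m = 0], by the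
   cocycle. *)
have := hC (1, 0, 0) 0; have := hC (0, 0, 1) 0; rewrite !deckM.
move=> /deck_inj[_ e1 _] /deck_inj[_ e2 _].
have -> : k = 0 by lra.
have -> : m = 0 by lra.
exact: deck_angle_center.
Qed.

End NotProduct.

(** * Ends *)

Section OneEnd.
Variable R : realType.

Lemma sign_constant (Z : topologicalType) (g : Z -> R) (z0 : Z) :
  connected [set: Z] -> continuous g -> (forall z, 1 < `|g z|) -> 1 < g z0 ->
  forall z, 1 < g z.
Proof.
move=> cZ cg g1 gz0 z.
suff : [set z | 1 < g z] = setT by move/seteqP => [_ /(_ z I)].
apply: connected_clopen => //; first by exists z0.
  exact: (open_preimage cg (@open_gt R 1)).
rewrite (_ : ~` _ = g @^-1` [set x | x < -1]).
  exact: (open_preimage cg (@open_lt R (-1))).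
apply/seteqP; split=> y /=; last by lra.
have := g1 y; rewrite lter_normr; lra.
Qed.

(** Off the square times [K] one has [|h| > 1], and this region is swept out by connected sets on
    which the sign of [h] cannot change: the copy of [S] over the corner [(t, t)] just outside the
    square, the lines through that corner, which avoid the square, and lines crossing those. So
    [h > 1] off a compact set, on which [h] has a minimum if it is nonempty. *)
Lemma one_end_pos (S : topologicalType) (h : R * R * S -> R) (rho : R)
    (K : set S) (s1 : S) :
  connected [set: S] -> continuous h -> compact K ->
  (forall x s, `|h (x, s)| <= 1 -> [/\ `|x.1| <= rho, `|x.2| <= rho & K s]) ->
  0 <= rho -> 1 < h ((rho + 1, rho + 1), s1) -> exists B, forall w, B <= h w.
Proof.
move=> cS ch cK hb rho0 h1; pose t := rho + 1.
have norm_t : rho < `|t| by rewrite /t ger0_norm; lra.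
have out x s : (rho < `|x.1|) || (rho < `|x.2|) -> 1 < `|h (x, s)|.
  by move=> xo; rewrite ltNge; apply/negP => /hb[? ? _]; lra.
have ct (s : S) : continuous (fun x => h (x, s)).
  exact: (comp_continuous (@pairl_continuous _ _ s) ch).
have hor s b : (forall a, 1 < `|h ((a, b), s)|) -> 1 < h ((t, b), s) ->
    forall a, 1 < h ((a, b), s).
  apply: (sign_constant (g := fun a => h ((a, b), s))); first exact: connectedR.
  exact: (comp_continuous (@pairl_continuous R R b) (ct s)).
have ver s a : (forall b, 1 < `|h ((a, b), s)|) -> 1 < h ((a, t), s) ->
    forall b, 1 < h ((a, b), s).
  apply: (sign_constant (g := fun b => h ((a, b), s))); first exact: connectedR.
  exact: (comp_continuous (@pairr_continuous R R a) (ct s)).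
have corner s : 1 < h ((t, t), s).
  apply: (sign_constant (g := fun s => h ((t, t), s)) cS _ _ h1) => [|{}s].
    exact: (comp_continuous (@pairr_continuous _ _ (t, t)) ch).
  by apply: out; rewrite norm_t.
have top s a : 1 < h ((a, t), s).
  by apply: hor => [{}a|]; [apply: out; rewrite norm_t orbT|exact: corner].
have right s b : 1 < h ((t, b), s).
  by apply: ver => [{}b|]; [apply: out; rewrite norm_t|exact: top].
have outside x s : (rho < `|x.1|) || (rho < `|x.2|) -> 1 < h (x, s).
  case: x => a b /orP[/= ha|/= hb'].
    by apply: ver => [{}b|]; [apply: out; rewrite /= ha|exact: top].
  by apply: hor => [{}a|]; [apply: out; rewrite /= hb' orbT|exact: right].
(* Over a point outside [K] the whole plane lies in the good region, even the square, so any
   vertical line can be followed from the line at height [t]. *)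
have far x s : ~ K s -> 1 < h (x, s).
  case: x => a b Ks.
  have o y : 1 < `|h (y, s)| by rewrite ltNge; apply/negP => /hb[].
  by apply: ver => [{}b|]; [exact: o|exact: top].
pose A := (`[- rho, rho]%classic `*` `[- rho, rho]%classic) `*` K.
have hA w : ~ A w -> 1 < h w.
  case: w => -[a b] s nA.
  have [Ks|/far//] := pselect (K s).
  apply: outside; apply/negPn/negP; rewrite negb_or -!leNgt !ler_norml /= => /andP[? ?].
  by apply: nA; split=> //; split; rewrite /= in_itv.
have [A0|A0] := pselect (A !=set0); last first.
  by exists 1 => w; apply/ltW/hA => Aw; apply: A0; exists w.
have cA : compact A.
  by do 2!(apply: compact_setX => //); exact: segment_compact.
have [w0 _ hw0] := compact_EVT_min A0 cA (continuous_subspaceT ch).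
exists (Num.min 1 (h w0)) => w; rewrite ge_min.
have [Aw|/hA/ltW->//] := pselect (A w).
by rewrite (hw0 w) ?orbT// inE.
Qed.

Lemma one_end (S : topologicalType) (h : R * R * S -> R) (rho : R)
    (K : set S) (s1 : S) :
  connected [set: S] -> continuous h -> compact K ->
  (forall x s, `|h (x, s)| <= 1 -> [/\ `|x.1| <= rho, `|x.2| <= rho & K s]) ->
  0 <= rho ->
  (exists B, forall w, B <= h w) \/ (exists B, forall w, h w <= B).
Proof.
move=> cS ch cK hb rho0; pose x1 := (rho + 1, rho + 1).
have : 1 < `|h (x1, s1)|.
  rewrite ltNge; apply/negP => /hb[/= + _ _].
  by rewrite ger0_norm; lra.
rewrite lter_normr => /orP[h1|h1].
  by left; exact: (one_end_pos cS ch cK hb rho0 h1).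
right; have [|x s|B hB] := one_end_pos (h := fun w => - h w) cS _ cK _ rho0 h1.
- exact: oppr_continuous.
- by rewrite normrN; exact: hb.
- by exists (- B) => w; rewrite lerNr.
Qed.

Lemma open_quotient_continuous (E B T : topologicalType) (p : E -> B)
    (h : B -> T) :
  (forall A, open A -> open (p @` A)) -> (forall b, exists x, p x = b) ->
  continuous (h \o p) -> continuous h.
Proof.
move=> op sp chp; apply/continuousP => A oA.
rewrite (_ : h @^-1` A = p @` ((h \o p) @^-1` A)).
  by apply: op; exact: open_preimage.
apply/seteqP; split=> [b Ab|_ [x Ax <-]//].
by have [x xb] := sp b; exists x => //=; rewrite xb.
Qed.

Definition xheight (x : X R) : R := (repr x).1.1.

Lemma xheightE (z : 'rV[R]_4) : xheight (Xparam z) = z 0 (inord 0).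
Proof.
rewrite /xheight.
have [y yx] := Mparam_surj (repr (Xparam z)).
have /Xparam_eqP[[[k l] m] zy] : Xparam y = Xparam z.
  by rewrite {1}/Xparam yx /Defs.proj reprK.
by rewrite -yx zy deckE.
Qed.

Lemma xheight_continuous : continuous xheight.
Proof.
apply: (open_quotient_continuous (@Xparam_open R) (@Xparam_surj R)).
rewrite (_ : xheight \o _ = fun z : 'rV[R]_4 => z 0 (inord 0)).
  exact: coord_continuous.
by apply/funext => z; rewrite /= xheightE.
Qed.

(** The box with p in [[-1, 1]] and q, r, s in [[0, 1]] is compact and meets every orbit of the deck
    group in the band. *)
Lemma xheight_compact : exists2 K : set (X R), compact K &
  forall x, `|xheight x| <= 1 -> K x.
Proof.
pose b (i : 'I_4) : set R := if i == inord 0 then `[-1, 1]%classic else `[0, 1]%classic.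
exists (@Xparam R @` [set v : 'rV[R]_4 | forall i, b i (v 0 i)]).
  apply: continuous_compact; first exact/continuous_subspaceT/Xparam_continuous.
  by apply: rV_compact => i; rewrite /b; case: ifP => _; exact: segment_compact.
move=> x; have [z <-] := Xparam_surj x; rewrite xheightE => z1.
have fl (t : R) : (`[0, 1]%classic : set R) (t + (- Num.floor t)%:~R).
  rewrite /= in_itv /= intrN; have := floor_le_tmp t; have := floorD1_gt t.
  rewrite intrD; lra.
(* [l] is the integer part of r after the shear by [k], since [deck] applies that shear before
   translating by [l]. *)
pose k := - Num.floor (z 0 (inord 1)).
pose l := - Num.floor (z 0 (inord 2) + k%:~R * z 0 (inord 3)).
pose m := - Num.floor (z 0 (inord 3)).
exists (deck (k, l, m) z); last by apply/esym/Xparam_eqP; exists (k, l, m).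
have ne i j : (i < 4)%N -> (j < 4)%N -> i != j -> (inord i == inord j :> 'I_4) = false.
  by move=> hi hj ij; apply/negbTE; rewrite -val_eqE /= !inordK.
apply: ord4_ind; rewrite /b !deckE ?eqxx ?ne//; try exact: fl.
by rewrite /= in_itv /= -ler_norml.
Qed.

End OneEnd.

(** * The contradiction between the two counts of ends *)

Section NotHomeomorphic.
Variable R : realType.

Lemma X_not_product (Y S : topologicalType) (f : Y -> @U R) :
  covering f -> ~ homeomorphic (X R) (Y * S)%type.
Proof.
move=> hf [phi [psi [cphi cpsi phiK psiK]]].
have cS := factor_connected cphi psiK.
have [PT [ut [c [cPT cut fPT fut [utPT PTd]]]]] := product_lifts hf cphi.
have c0 g := angle_invariant hf cphi cpsi phiK psiK cPT cut fPT fut utPT PTd g.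
have PTdeck g z : PT (deck g z) = PT z.
  by rewrite PTd c0 addr0 -surjective_pairing.
pose Q x := PT (sval (cid (Xparam_surj x))).
(* With [c = 0] the lift [PT] is constant on deck orbits, so the choice of a preimage in [Q] is
   immaterial and [Q] is the angle lift on X itself. *)
have QE z : Q (Xparam z) = PT z.
  by rewrite /Q; case: cid => y /= /esym/Xparam_eqP[g ->]; rewrite PTdeck.
have cQ : continuous Q.
  apply: (open_quotient_continuous (@Xparam_open R) (@Xparam_surj R)).
  by rewrite (_ : Q \o _ = PT)//; apply/funext.
have fQ w : ucov (Q (psi w)) = f w.1.
  by have [z zx] := Xparam_surj (psi w); rewrite -zx QE fPT zx psiK.
pose s0 := (phi (Xparam 0)).2.
(* Restricting [Q] to the slice [Y * {s0}] lifts [f] to the plane; this lift is the inverse of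
   [ut]. *)
pose G y := Q (psi (y, s0)).
have cG : continuous G.
  exact: (comp_continuous (comp_continuous (@pairl_continuous Y S s0) cpsi) cQ).
have fG y : ucov (G y) = f y by rewrite fQ.
have Gut x : G (ut x) = x.
  apply: (@lift_unique _ _ _ (@ucov_covering R) _ (G \o ut) id (PT 0)) => //.
  - exact: connected_plane.
  - exact: comp_continuous.
  - by move=> y; exact: cvg_id.
  - by move=> y /=; rewrite fG fut.
  - by rewrite /= utPT /G /s0 -surjective_pairing phiK QE.
have utG y : ut (G y) = y.
  have [z zx] := Xparam_surj (psi (y, s0)).
  by rewrite /G -zx QE utPT zx psiK.
(* The height of X, transported to the product of the plane and [S]. *)
pose h w := xheight (psi (ut w.1, w.2)).
have ch : continuous h.
  apply: (@comp_continuous _ _ _ (fun w => psi (ut w.1, w.2)) (@xheight R)).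
    apply: (@comp_continuous _ _ _ (fun w : R * R * S => (ut w.1, w.2)) psi) => //.
    apply: pair_continuous; last exact: snd_continuous.
    exact: (comp_continuous (@fst_continuous _ _) cut).
  exact: xheight_continuous.
have hE x : h (G (phi x).1, (phi x).2) = xheight x.
  by rewrite /h /= utG -surjective_pairing phiK.
have [K cK hK] := xheight_compact R.
have cK1 : compact ((G \o fst \o phi) @` K).
  apply: continuous_compact => //; apply: continuous_subspaceT.
  exact: (comp_continuous cphi (comp_continuous (@fst_continuous Y S) cG)).
have cK2 : compact ((snd \o phi) @` K).
  apply: continuous_compact => //; apply: continuous_subspaceT.
  exact: (comp_continuous cphi (@snd_continuous Y S)).
have [rho rho0 hrho] : exists2 rho : R, 0 <= rho & forall x,
    ((G \o fst \o phi) @` K) x -> `|x.1| <= rho /\ `|x.2| <= rho.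
  have [K0|K0] := pselect (((G \o fst \o phi) @` K) !=set0); last first.
    by exists 0 => // x Kx; case: K0; exists x.
  have cn : continuous (fun x : R * R => `|x.1| + `|x.2|).
    apply: addr_continuous.
      exact: (comp_continuous (@fst_continuous R R) (@norm_continuous _ R)).
    exact: (comp_continuous (@snd_continuous R R) (@norm_continuous _ R)).
  have [x0 _ hx0] := compact_EVT_max K0 cK1 (continuous_subspaceT cn).
  exists (`|x0.1| + `|x0.2|); first by rewrite addr_ge0.
  move=> x Kx; have := hx0 x; rewrite inE => /(_ Kx).
  by have := normr_ge0 x.1; have := normr_ge0 x.2; split; lra.
have [|[B hB]|[B hB]] := one_end (h := h) (rho := rho) s0 cS ch cK2 _ rho0.
- move=> x s xs.
  have Kx : K (psi (ut x, s)) by exact: hK.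
  have [|? ?] := hrho x.
    by exists (psi (ut x, s)) => //=; rewrite psiK Gut.
  split=> //; exists (psi (ut x, s)) => //=; by rewrite psiK.
(* Every real number is a height: [B - 1] violates the lower bound, and [B + 1] the upper one in the
   other case. *)
- have := hB (G (phi (Xparam (row4 (B - 1) 0 0 0))).1, (phi (Xparam (row4 (B - 1) 0 0 0))).2).
  by rewrite hE xheightE row4E; lra.
- have := hB (G (phi (Xparam (row4 (B + 1) 0 0 0))).1, (phi (Xparam (row4 (B + 1) 0 0 0))).2).
  by rewrite hE xheightE row4E; lra.
Qed.

End NotHomeomorphic.

(** * Smooth functions *)

Section SmoothCalculus.
Variables (R : realType) (n : nat).
Implicit Types (V : normedModType R) (k : nat) (i : 'I_n).

Lemma C_kS k V (O : set 'rV[R]_n) (f : 'rV[R]_n -> V) :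
  (forall y, O y -> {for y, continuous f}) ->
  (forall i y, O y -> derivable f y (basis_vec R i)) ->
  (forall i, C_k k O (fun y => 'D_(basis_vec R i) f y)) -> C_k k.+1 O f.
Proof.
by move=> cf df ck; split=> // i; split; [exact: df|exact: ck].
Qed.

Lemma eq_C_k k V (O : set 'rV[R]_n) (f g : 'rV[R]_n -> V) :
  C_k k O f -> g =1 f -> C_k k O g.
Proof. by move=> cf /funext ->. Qed.

Lemma C_k_continuous k V (O : set 'rV[R]_n) (f : 'rV[R]_n -> V) :
  C_k k O f -> forall y, O y -> {for y, continuous f}.
Proof. by case: k => [[]|k []]. Qed.

Lemma C_k_derivable k V (O : set 'rV[R]_n) (f : 'rV[R]_n -> V) :
  C_k k.+1 O f -> forall i y, O y -> derivable f y (basis_vec R i).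
Proof. by case=> _ h i; case: (h i). Qed.

Lemma C_k_derive k V (O : set 'rV[R]_n) (f : 'rV[R]_n -> V) :
  C_k k.+1 O f -> forall i, C_k k O (fun y => 'D_(basis_vec R i) f y).
Proof. by case=> _ h i; case: (h i). Qed.

(** A local expression is meaningful only on the image of a chart. It is compared near each point
    with a globally smooth formula, which may change from point to point. *)
Lemma C_k_local k V (O : set 'rV[R]_n) (f : 'rV[R]_n -> V) :
  (forall y, O y -> exists2 g, C_k k setT g & {near y, g =1 f}) -> C_k k O f.
Proof.
elim: k f => [|k IH] f h.
  split=> // y /h[g cg gf]; apply: (near_eq_continuous gf).
  exact: (C_k_continuous cg).
apply: C_kS.
- move=> y /h[g cg gf]; apply: (near_eq_continuous gf).
  exact: (C_k_continuous cg).
- move=> i y /h[g /C_k_derivable dg gf].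
  by apply: (near_eq_derivable gf); exact: dg.
- move=> i; apply: IH => y /h[g /C_k_derive cg gf].
  exists (fun y => 'D_(basis_vec R i) g y) => //.
  by apply: filterS (nbhs_interior gf) => z gz; exact: near_eq_derive.
Qed.

Lemma C_k_le k V (f : 'rV[R]_n -> V) : C_k k.+1 setT f -> C_k k setT f.
Proof.
elim: k f => [|k IH] f ckf; first by split=> //; exact: (C_k_continuous ckf).
apply: C_kS.
- exact: (C_k_continuous ckf).
- exact: (C_k_derivable ckf).
- by move=> i; apply: IH; exact: (C_k_derive ckf).
Qed.

Lemma C_k_cst k V (a : V) : C_k k setT (fun _ : 'rV[R]_n => a).
Proof.
elim: k a => [|k IH] a; first by split=> // y _; exact: (@cst_continuous _ _ a).
apply: C_kS => [y _|i y _|i]; first exact: (@cst_continuous _ _ a).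
  exact: derivable_cst.
by apply: (eq_C_k (IH 0)) => y; exact: derive_cst.
Qed.

Lemma C_k_add k V (f g : 'rV[R]_n -> V) : C_k k setT f -> C_k k setT g ->
  C_k k setT (fun y => f y + g y).
Proof.
elim: k f g => [|k IH] f g cf cg.
  split=> // y _; apply: continuousD; first exact: (C_k_continuous cf).
  exact: (C_k_continuous cg).
have df := C_k_derivable cf; have dg := C_k_derivable cg.
apply: C_kS => [y _|i y _|i].
- by apply: continuousD; [exact: (C_k_continuous cf)|exact: (C_k_continuous cg)].
- by apply: derivableD; [exact: df|exact: dg].
- apply: (eq_C_k (IH _ _ (C_k_derive cf i) (C_k_derive cg i))) => y.
  by apply: deriveD; [exact: df|exact: dg].
Qed.

Lemma C_k_mul k (f g : 'rV[R]_n -> R^o) : C_k k setT f -> C_k k setT g ->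
  C_k k setT (fun y => f y * g y : R^o).
Proof.
elim: k f g => [|k IH] f g cf cg.
  split=> // y _; apply: continuousM; first exact: (C_k_continuous cf).
  exact: (C_k_continuous cg).
have df := C_k_derivable cf; have dg := C_k_derivable cg.
apply: C_kS => [y _|i y _|i].
- by apply: continuousM; [exact: (C_k_continuous cf)|exact: (C_k_continuous cg)].
- by apply: derivableM; [exact: df|exact: dg].
- apply: (eq_C_k (C_k_add (IH _ _ (C_k_le cf) (C_k_derive cg i))
    (IH _ _ (C_k_le cg) (C_k_derive cf i)))) => y.
  by apply: deriveM; [exact: df|exact: dg].
Qed.

Lemma is_derive_coord (j : 'I_n) (y v : 'rV[R]_n) :
  is_derive y v (fun z : 'rV[R]_n => z 0 j : R^o) (v 0 j).
Proof.
have did : derivable (@id 'rV[R]_n) y v by exact: derivable_id.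
have := did; rewrite derivable_mxP => /(_ 0 j) dj.
apply: DeriveDef => //.
by have := derive_mx did; rewrite derive_id => /matrixP/(_ 0 j) ->; rewrite mxE.
Qed.

Lemma C_k_coord k (j : 'I_n) : C_k k setT (fun y : 'rV[R]_n => y 0 j : R^o).
Proof.
have dc i y := is_derive_coord j y (basis_vec R i).
case: k => [|k]; first by split=> // y _; exact: coord_continuous.
apply: C_kS => [y _|i y _|i]; first exact: coord_continuous.
  by have [] := dc i y.
apply: (eq_C_k (C_k_cst k (basis_vec R i 0 j : R^o))) => y.
by have [] := dc i y.
Qed.

Lemma derive_line (V W : normedModType R) (f : V -> W) (x v : V) :
  'D_v f x = 'D_1 (fun h : R => f (h *: v + x)) 0.
Proof.
rewrite /derive; set g1 := fun h => h^-1 *: _; set g2 := fun h => h^-1 *: _.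
suff -> : g1 = g2 by [].
by rewrite funeqE /g1 /g2 => h /=; rewrite addr0 scale0r add0r [_%:A]mulr1.
Qed.

(** Restricting [f] to the line through [x] along [v] reduces this to the chain rule in one
    variable; only the derivative in the direction [v] is involved. *)
Lemma is_derive_comp (V : normedModType R) (f : V -> R^o) (phi : R -> R)
    (x v : V) (df dphi : R) : is_derive x v f df -> is_derive (f x) 1 phi dphi ->
  is_derive x v (fun y => phi (f y) : R^o) (df * dphi).
Proof.
move=> [Df Ef] [Dp Ep].
pose g (h : R) := f (h *: v + x).
have Dg : derivable g 0 1 by exact: ((derivable1P f x v).1 Df).
have g0 : g 0 = f x by rewrite /g scale0r add0r.
have Eg : 'D_1 g 0 = df.
  by rewrite -Ef; exact/esym/derive_line.
have hg : is_derive (0 : R) 1 g df by apply: DeriveDef.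
have hp : is_derive (g 0) 1 phi dphi by rewrite g0; apply: DeriveDef.
have [Dc Ec] := is_derive1_comp hp hg.
apply: DeriveDef; first exact: ((derivable1P (fun y => phi (f y) : R^o) x v).2 Dc).
by rewrite mulrC (derive_line (fun y => phi (f y) : R^o)).
Qed.

(** The two claims are proved together because differentiation exchanges cosine and sine. *)
Lemma C_k_cos_sin k (f : 'rV[R]_n -> R^o) : C_k k setT f ->
  C_k k setT (fun y => cos (f y) : R^o) /\ C_k k setT (fun y => sin (f y) : R^o).
Proof.
elim: k f => [|k IH] f cf.
  have cf0 := C_k_continuous cf.
  split; split=> // y _.
    by apply: continuous_comp; [exact: cf0|exact: continuous_cos].
  by apply: continuous_comp; [exact: cf0|exact: continuous_sin].
have cf0 := C_k_continuous cf; have df := C_k_derivable cf.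
have [ccos csin] := IH f (C_k_le cf).
have dcos i y : is_derive y (basis_vec R i) (fun y => cos (f y) : R^o)
    ('D_(basis_vec R i) f y * - sin (f y)).
  by apply: is_derive_comp; apply: DeriveDef => //; exact: df.
have dsin i y : is_derive y (basis_vec R i) (fun y => sin (f y) : R^o)
    ('D_(basis_vec R i) f y * cos (f y)).
  by apply: is_derive_comp; apply: DeriveDef => //; exact: df.
split; apply: C_kS => [y _|i y _|i].
- by apply: continuous_comp; [exact: cf0|exact: continuous_cos].
- by have [] := dcos i y.
- apply: (eq_C_k (C_k_mul (C_k_derive cf i)
    (C_k_mul (C_k_cst k (-1 : R^o)) csin))) => y.
  by have [_ ->] := dcos i y; rewrite mulN1r.
- by apply: continuous_comp; [exact: cf0|exact: continuous_sin].
- by have [] := dsin i y.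
- apply: (eq_C_k (C_k_mul (C_k_derive cf i) ccos)) => y.
  by have [_ ->] := dsin i y.
Qed.

Lemma C_k_row k m (f : 'rV[R]_n -> 'rV[R]_m) :
  (forall j, C_k k setT (fun y => f y 0 j : R^o)) -> C_k k setT f.
Proof.
elim: k f => [|k IH] f cf.
  by split=> // y _; apply: row_continuous_at => j; exact: (C_k_continuous (cf j)).
have df i y : derivable f y (basis_vec R i).
  by apply/derivable_mxP => a j; rewrite (ord1 a); exact: (C_k_derivable (cf j)).
apply: C_kS => [y _|i y _|i].
- by apply: row_continuous_at => j; exact: (C_k_continuous (cf j)).
- exact: df.
- apply: IH => j; apply: (eq_C_k (C_k_derive (cf j) i)) => y.
  by rewrite derive_mx// mxE.
Qed.

End SmoothCalculus.

(** * Jacobians *)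

Section Jacobians.
Variable R : realType.

Lemma near_eq_diff (V W : normedModType R) (f g : V -> W) (x : V) :
  {near x, f =1 g} -> differentiable f x -> 'd g x = 'd f x :> (V -> W).
Proof.
move=> fg df; apply: diff_unique; first exact: diff_continuous.
have gx : f x = g x := nbhs_singleton fg.
have := diff_locally df => /eqaddoP h; apply/eqaddoP => e e0.
have fg0 : \forall k \near (0 : V), f (k + x) = g (k + x).
  by move: fg; rewrite (near_shift 0 x) subr0.
apply: filterS (filterI (h e e0) fg0) => k [hk fgk].
by move: hk; rewrite /= !fctE /= gx fgk.
Qed.

Lemma near_eq_jacobian m n (f g : 'rV[R]_m -> 'rV[R]_n) y :
  {near y, f =1 g} -> differentiable f y -> jacobian g y = jacobian f y.
Proof.
move=> fg df.
exact (f_equal (fun h : 'rV[R]_m -> 'rV[R]_n => lin1_mx h) (near_eq_diff fg df)).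
Qed.

Lemma differentiable_row m (V : normedModType R) (f : V -> 'rV[R]_m) x :
  (forall j, differentiable (fun y => f y 0 j : R^o) x) -> differentiable f x.
Proof.
move=> df.
have -> : f = \sum_(j < m) (fun y => (f y 0 j : R^o) *: delta_mx 0 j).
  by apply/funext => y; rewrite fct_sumE [LHS]row_sum_delta.
by apply: differentiable_sum => j; apply: differentiableZl; exact: df.
Qed.

Lemma jacobian_row m n (f : 'rV[R]_m -> 'rV[R]_n) y i j :
  differentiable f y ->
  jacobian f y i j = 'D_(basis_vec R i) (fun z => f z 0 j : R^o) y.
Proof.
move=> df; have := deriveEjacobian (basis_vec R i) df.
rewrite -rowE => /rowP/(_ j); rewrite !mxE => <-.
by rewrite derive_mx ?mxE//; exact: diff_derivable.
Qed.

(* Every lift to R^4 of the maps considered has this shape; the first component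
   is moved by a function of [q] only. *)
Definition shear (phi : R -> R) (a k l m : R) (y : 'rV[R]_4) : 'rV[R]_4 :=
  row4 (y 0 (inord 0) + phi (y 0 (inord 1))) (y 0 (inord 1) + a)
    (y 0 (inord 2) + k * y 0 (inord 3) + l) (y 0 (inord 3) + m).

Lemma deck_shear phi a g y :
  deck g (shear phi a 0 0 0 y) = shear phi (a + g.1.1%:~R) g.1.1%:~R g.1.2%:~R g.2%:~R y.
Proof.
by case: g => -[k l] m; apply: row4P; rewrite deckE /shear !row4E //=; ring.
Qed.

Lemma differentiable_coord0 n (j : 'I_n) (y : 'rV[R]_n) :
  differentiable (fun z : 'rV[R]_n => z 0 j : R^o) y.
Proof. exact: differentiable_coord. Qed.

Lemma shear_is_derive phi dphi a k l m (y v : 'rV[R]_4) :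
  is_derive (y 0 (inord 1)) 1 phi dphi ->
  [/\ is_derive y v (fun z => shear phi a k l m z 0 (inord 0) : R^o)
       (v 0 (inord 0) + v 0 (inord 1) * dphi),
     is_derive y v (fun z => shear phi a k l m z 0 (inord 1) : R^o) (v 0 (inord 1)),
     is_derive y v (fun z => shear phi a k l m z 0 (inord 2) : R^o)
       (v 0 (inord 2) + k * v 0 (inord 3)) &
     is_derive y v (fun z => shear phi a k l m z 0 (inord 3) : R^o) (v 0 (inord 3))].
Proof.
move=> dp; have dc j := is_derive_coord j y v.
have dcst (b : R) : is_derive y v (fun _ : 'rV[R]_4 => b : R^o) 0.
  exact: is_derive_cst.
rewrite /shear; split; under eq_fun do rewrite row4E.
- exact: (is_deriveD (dc _) (is_derive_comp (dc _) dp)).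
- by rewrite -[X in is_derive _ _ _ X]addr0; exact: (is_deriveD (dc _) (dcst a)).
- rewrite -[X in is_derive _ _ _ X]addr0.
  have dZ : is_derive y v (fun z : 'rV[R]_4 => k * z 0 (inord 3) : R^o)
      (k * v 0 (inord 3)).
    by have dcj := dc (inord 3); exact: is_deriveZ.
  exact: (is_deriveD (is_deriveD (dc _) dZ) (dcst l)).
- by rewrite -[X in is_derive _ _ _ X]addr0; exact: (is_deriveD (dc _) (dcst m)).
Qed.

Lemma shear_differentiable phi a k l m (y : 'rV[R]_4) :
  derivable phi (y 0 (inord 1)) 1 -> differentiable (shear phi a k l m) y.
Proof.
move=> dp; apply: differentiable_row; rewrite /shear.
have dc (j : 'I_4) := differentiable_coord0 j y.
have dcst (b : R) : differentiable (fun _ : 'rV[R]_4 => b : R^o) y.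
  exact: differentiable_cst.
apply: ord4_ind; under eq_fun do rewrite row4E.
- apply: (differentiableD (dc _)).
  apply: (@differentiable_comp _ _ _ _ (fun z : 'rV[R]_4 => z 0 (inord 1) : R^o) phi) => //.
  exact/derivable1_diffP.
- exact: (differentiableD (dc _) (dcst a)).
- have dZ : differentiable (fun z : 'rV[R]_4 => k * z 0 (inord 3) : R^o) y.
    by apply: differentiableZ; exact: dc.
  exact: (differentiableD (differentiableD (dc _) dZ) (dcst l)).
- exact: (differentiableD (dc _) (dcst m)).
Qed.

Lemma sum4 (V : zmodType) (F : 'I_4 -> V) :
  \sum_i F i = F (inord 0) + F (inord 1) + F (inord 2) + F (inord 3).
Proof.
rewrite !big_ord_recr big_ord0 /= add0r.
by do !congr (_ + _); congr F; apply/val_inj; rewrite /= inordK.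
Qed.

Lemma OmegaE (i k : nat) : (i < 4)%N -> (k < 4)%N ->
  @Omega R (inord i) (inord k) = nth 0 (nth [::]
    [:: [:: 0; 1; 0; 0]; [:: -1; 0; 0; 0];
        [:: 0; 0; 0; 1]; [:: 0; 0; -1; 0]] i) k.
Proof. by move=> i4 k4; rewrite mxE !inordK. Qed.

Lemma mul_Omega (u v : 'rV[R]_4) : (u *m Omega R *m v^T) 0 0 =
  u 0 (inord 0) * v 0 (inord 1) - u 0 (inord 1) * v 0 (inord 0)
  + u 0 (inord 2) * v 0 (inord 3) - u 0 (inord 3) * v 0 (inord 2).
Proof.
rewrite mxE sum4 !mxE !sum4 !mxE !inordK//=; ring.
Qed.

Lemma mul_row_form n (J A : 'M[R]_n) i i' :
  (J *m A *m J^T) i i' = (row i J *m A *m (row i' J)^T) 0 0.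
Proof. by rewrite -row_mul !mxE; apply: eq_bigr => s _; rewrite [row _ _ _ _]mxE !mxE. Qed.

(** The shear adds a multiple of dq to dp and a multiple of ds to dr, which changes neither wedge
    product. *)
Lemma jacobian_shear_Omega phi a k l m (y : 'rV[R]_4) :
  derivable phi (y 0 (inord 1)) 1 ->
  let J := jacobian (shear phi a k l m) y in J *m Omega R *m J^T = Omega R.
Proof.
move=> dp J; have dS := shear_differentiable a k l m dp.
have Jr i : [/\ J i (inord 0) = basis_vec R i 0 (inord 0)
      + basis_vec R i 0 (inord 1) * 'D_1 phi (y 0 (inord 1)),
    J i (inord 1) = basis_vec R i 0 (inord 1),
    J i (inord 2) = basis_vec R i 0 (inord 2) + k * basis_vec R i 0 (inord 3) &
    J i (inord 3) = basis_vec R i 0 (inord 3)].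
  have [d0 d1 d2 d3] := shear_is_derive a k l m (basis_vec R i) (DeriveDef dp erefl).
  rewrite /J !jacobian_row//.
  by split; [case: d0|case: d1|case: d2|case: d3].
clearbody J; apply/matrixP => i i'.
rewrite mul_row_form mul_Omega 8!mxE.
have [-> -> -> ->] := Jr i; have [-> -> -> ->] := Jr i'.
have eqE (s t : nat) : (s < 4)%N -> (t < 4)%N ->
    (inord s == inord t :> 'I_4) = (s == t).
  by move=> s4 t4; rewrite -val_eqE /= !inordK.
move: i i'; apply: ord4_ind; apply: ord4_ind; rewrite /basis_vec !mxE !eqE// !inordK//=; ring.
Qed.

End Jacobians.

(** * Manifolds parametrized by R^4 *)

Section Charts.
Variable R : realType.

(** The parameter [D] treats together [M], where only deck transformations with [k = 0] are divided
    out, and X, where all are. *)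
Definition deck_quotient (D : set (int * int * int)) (E : Type)
    (pi : 'rV[R]_4 -> E) : Prop :=
  forall u v, pi u = pi v <-> exists2 g, D g & v = deck g u.

Lemma chart_mapK (E : topologicalType) n (c : chart R E n) y :
  is_chart c -> cimg c y -> cmap c (cinv c y) = y /\ cdom c (cinv c y).
Proof. by move=> [_ _ _ _ ck] [x cx <-]; rewrite ck. Qed.

Lemma chart_img_open (E : topologicalType) n (c : chart R E n) (O : set E) :
  is_chart c -> open O -> open (cmap c @` (cdom c `&` O)).
Proof.
move=> hc oO; have [od oi cm ci ck] := hc.
rewrite (_ : _ @` _ = cimg c `&` cinv c @^-1` O); last first.
  apply/seteqP; split=> [_ [x [cx Ox] <-]|y [cy Oy]].
    by split; [exists x|rewrite /= ck].
  by have [e d] := chart_mapK hc cy; exists (cinv c y).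
move: ci; rewrite continuous_open_subspace// => ci.
rewrite openE => y [cy Oy]; apply: filterI; first exact: open_nbhs_nbhs.
by apply: ci; [rewrite inE|exact: open_nbhs_nbhs].
Qed.

(** At [y] the chart [d] selects one lift, [deck g (G y)]. By continuity [deck g \o G] stays in the
    open image of [d] near [y], and there [cmap d] inverts [pi'], so the same [g] persists. *)
Lemma deck_near D (E E' : topologicalType) m (phi : 'rV[R]_m -> E)
    (pi' : 'rV[R]_4 -> E') (c : chart R E m) (d : chart R E' 4)
    (F : E -> E') (G : 'rV[R]_m -> 'rV[R]_4) (y : 'rV[R]_m) :
  deck_quotient D pi' -> param_atlas phi c -> param_atlas pi' d ->
  (forall z, F (phi z) = pi' (G z)) -> {for y, continuous G} ->
  cimg c y -> cdom d (F (cinv c y)) ->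
  exists g, {near y, (fun z => deck g (G z)) =1 local_expr F c d}.
Proof.
move=> pE [hc cE] [hd dE] FG cG cy dFy.
have [_ oic _ _ _] := hc; have [_ oid _ _ dK] := hd.
have y1d : cimg d (cmap d (F (cinv c y))) by exists (F (cinv c y)).
have [g Dg yg] : exists2 g, D g & cmap d (F (cinv c y)) = deck g (G y).
  apply/pE; rewrite -(dE _ y1d) dK// cE// FG.
exists g.
have nd : nbhs y ((fun z => deck g (G z)) @^-1` cimg d).
  apply: (@continuous_comp _ _ _ G (deck g)) => //; first exact: deck_continuous.
  by apply: open_nbhs_nbhs; split=> //=; rewrite -yg.
have nc : nbhs y (cimg c) by exact: open_nbhs_nbhs.
apply: filterS (filterI nd nc) => z [zd zc].
have [zK _] := chart_mapK hd zd.
have -> : local_expr F c d z = cmap d (cinv d (deck g (G z))).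
  by rewrite /local_expr cE// dE// FG; congr (cmap d _); apply/pE; exists g.
by rewrite zK.
Qed.

Lemma deck_smooth k m (G : 'rV[R]_m -> 'rV[R]_4) g :
  (forall j, C_k k setT (fun z => G z 0 j : R^o)) ->
  C_k k setT (fun z => deck g (G z)).
Proof.
move=> cG; apply: C_k_row; apply: ord4_ind; case: g => -[a b] e.
- by apply: (eq_C_k (cG (inord 0))) => z; rewrite deckE.
- apply: (eq_C_k (C_k_add (cG (inord 1)) (C_k_cst m k (a%:~R : R^o)))) => z.
  by rewrite deckE.
- apply: (eq_C_k (C_k_add (C_k_add (cG (inord 2))
    (C_k_mul (C_k_cst m k (a%:~R : R^o)) (cG (inord 3))))
    (C_k_cst m k (b%:~R : R^o)))) => z.
  by rewrite deckE.
- apply: (eq_C_k (C_k_add (cG (inord 3)) (C_k_cst m k (e%:~R : R^o)))) => z.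
  by rewrite deckE.
Qed.

Section LiftedMap.
Variables (E E' : topologicalType) (m : nat) (phi : 'rV[R]_m -> E).
Variables (pi' : 'rV[R]_4 -> E') (F : E -> E') (G : 'rV[R]_m -> 'rV[R]_4).
Variable D : set (int * int * int).
Hypothesis pE : deck_quotient D pi'.
Hypothesis FG : forall z, F (phi z) = pi' (G z).

Lemma lifted_map_smooth (A : set (chart R E m)) :
  A `<=` param_atlas phi -> continuous F ->
  (forall k j, C_k k setT (fun z => G z 0 j : R^o)) ->
  smooth_map A (param_atlas pi') F.
Proof.
move=> AP cF cG; split=> // c d /AP Ac Ad; have [hc cE] := Ac; have [hd dE] := Ad.
split.
  by apply: chart_img_open => //; apply: open_preimage => //; case: hd.
move=> k; apply: C_k_local => _ [x [cx dFx] <-].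
have cy : cimg c (cmap c x) by exists x.
have cGy : {for cmap c x, continuous G}.
  by apply: row_continuous_at => j; exact: (C_k_continuous (cG k j)).
have dF : cdom d (F (cinv c (cmap c x))) by case: hc => _ _ _ _ ->.
have [g hg] := deck_near pE Ac Ad FG cGy cy dF.
exists (fun z => deck g (G z)) => //.
by apply: deck_smooth => j; exact: cG.
Qed.

End LiftedMap.

Lemma lifted_map_pullback D (E E' : topologicalType) (pi : 'rV[R]_4 -> E)
    (pi' : 'rV[R]_4 -> E') (F : E -> E') (f : R -> R) (a : R) :
  deck_quotient D pi' ->
  (forall z, F (pi z) = pi' (shear f a 0 0 0 z)) ->
  (forall t, derivable f t 1) ->
  is_pullback (param_atlas pi) (fun _ _ => Omega R)
    (param_atlas pi') (fun _ _ => Omega R) F.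
Proof.
move=> pE FG df c d x Ac Ad cx dFx J.
have [hc cE] := Ac.
have cy : cimg c (cmap c x) by exists x.
have dF : cdom d (F (cinv c (cmap c x))) by case: hc => _ _ _ _ ->.
have cG : {for cmap c x, continuous (shear f a 0 0 0)}.
  by apply: differentiable_continuous; apply: shear_differentiable; exact: df.
have [g hg] := deck_near pE Ac Ad FG cG cy dF.
have hg' : {near cmap c x,
    shear f (a + g.1.1%:~R) g.1.1%:~R g.1.2%:~R g.2%:~R =1 local_expr F c d}.
  by apply: filterS hg => z <-; rewrite deck_shear.
rewrite /J (near_eq_jacobian hg'); last by apply: shear_differentiable; exact: df.
by rewrite jacobian_shear_Omega//; exact: df.
Qed.

Lemma shear0 (y : 'rV[R]_4) : shear (fun _ => 0) 0 0 0 0 y = y.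
Proof. by apply: row4P; rewrite /shear !row4E; ring. Qed.

Lemma Omega_tr : (Omega R)^T = - Omega R.
Proof.
apply/matrixP; apply: ord4_ind; apply: ord4_ind;
  by rewrite [LHS]mxE [RHS]mxE !OmegaE//= ?oppr0 ?opprK.
Qed.

Lemma Omega_unit : Omega R \in unitmx.
Proof.
suff /mulmx1_unit[] : Omega R *m - Omega R = 1%:M by [].
have eqE (s t : nat) : (s < 4)%N -> (t < 4)%N ->
    (inord s == inord t :> 'I_4) = (s == t).
  by move=> s4 t4; rewrite -val_eqE /= !inordK.
rewrite mulmxN; apply/matrixP; apply: ord4_ind; apply: ord4_ind;
  by rewrite mxE [X in - X]mxE sum4 !OmegaE//= mxE eqE//=; ring.
Qed.

Section ParamManifold.
Variables (E : topologicalType) (pi : 'rV[R]_4 -> E).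
Hypotheses (cpi : continuous pi) (opi : forall A, open A -> open (pi @` A)).
Hypothesis spi : forall x, exists y, pi y = x.
Variable D : set (int * int * int).
Hypothesis pE : deck_quotient D pi.

Lemma param_chart x : exists2 c, param_atlas pi c & cdom c x.
Proof.
have [y yx] := spi x; pose B := ball y (1 / 2).
have oB : open B by exact: ball_open.
have injB u v : B u -> B v -> pi u = pi v -> u = v.
  move=> Bu Bv /pE[g _ vg].
  by rewrite vg -(@deck_discrete R y v u (0, 0, 0) g)// deck1.
have [s [cs sK]] := local_section opi y oB injB.
have sB : s @` (pi @` B) = B.
  apply/seteqP; split=> [_ [_ [u Bu <-] <-]|u Bu]; first by rewrite sK.
  by exists (pi u); [exists u|exact: sK].
exists (Chart (pi @` B) s pi); last by exists y => //; exact: ballxx.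
split; last by [].
split=> /=.
- exact: opi.
- by rewrite /cimg /= sB.
- by rewrite continuous_open_subspace//; exact: opi.
- exact: continuous_subspaceT.
- by move=> _ [u Bu <-]; rewrite sK.
Qed.

Lemma param_symplectic : closed [set xy : 'rV[R]_4 * 'rV[R]_4 | pi xy.1 = pi xy.2] ->
  symplectic_manifold (param_atlas pi) (fun _ _ => Omega R).
Proof.
move=> clpi; split.
- split.
  + exact: (open_quotient_hausdorff opi spi clpi).
  + exact: (open_quotient_second_countable cpi opi spi (@second_countable_row R 4)).
  + by move=> c [].
  + exact: param_chart.
  (* Transition maps are the local expressions of the identity, whose lift is the identity. *)
  + have [_ h] := lifted_map_smooth (phi := pi) (F := id) (G := id) pE
      (fun z => erefl) (@subset_refl _ _) (fun x => @cvg_id _ (nbhs x))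
      (fun k => @C_k_coord R 4 k).
    exact: h.
- split.
  + move=> c [[_ oi _ _ _] _]; split=> // k.
    apply: C_k_local => y _; exists (fun _ => Omega R); first exact: C_k_cst.
    by near=> z.
  + by move=> c y _ _; exact: Omega_tr.
  + apply: (@lifted_map_pullback D _ _ pi pi id (fun _ => 0) 0 pE).
      by move=> z; rewrite shear0.
    by move=> t; exact: derivable_cst.
- move=> c y _ _ i j k.
  by rewrite !derive_cst !addr0.
- by move=> c y _ _; exact: Omega_unit.
Unshelve. all: by end_near. Qed.

End ParamManifold.

End Charts.

(** * The group and its coadjoint action *)

Section GroupN.
Variable R : realType.

Lemma ord5_ind (P : 'I_5 -> Prop) : P (inord 0) -> P (inord 1) ->
  P (inord 2) -> P (inord 3) -> P (inord 4) -> forall i, P i.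
Proof.
move=> p0 p1 p2 p3 p4 i; rewrite -(inord_val i).
by case: i => -[|[|[|[|[|//]]]]].
Qed.

Lemma sum5 (V : zmodType) (F : 'I_5 -> V) : \sum_i F i =
  F (inord 0) + F (inord 1) + F (inord 2) + F (inord 3) + F (inord 4).
Proof.
rewrite !big_ord_recr big_ord0 /= add0r.
by do !congr (_ + _); congr F; apply/val_inj; rewrite /= inordK.
Qed.

Lemma mx5E (s : seq (seq R[i])) (i k : nat) : (i < 5)%N -> (k < 5)%N ->
  mx5 s (inord i) (inord k) = nth 0 (nth [::] s i) k.
Proof. by move=> i5 k5; rewrite mxE !inordK. Qed.

Definition zmat (a : R) (b : C R) (f : R) : 'M[R[i]]_5 := mx5
    [:: [:: 0; 0; 0;        0; f%:C];
        [:: 0; 0; 0;        0; 0   ];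
        [:: 0; 0; j R * a%:C; 0; b   ];
        [:: 0; 0; 0;        0; a%:C];
        [:: 0; 0; 0;        0; 0   ]].

Lemma nalgP (Z : 'M[R[i]]_5) : nalg Z <-> exists a b f, Z = zmat a b f.
Proof. by []. Qed.

Lemma nmat_coord (a : R) (b : C R) (f : R) : (acoord (nmat a b f) = a) *
  (bcoord (nmat a b f) = b) * (fcoord (nmat a b f) = f).
Proof. by rewrite /acoord /bcoord /fcoord /nmat !mx5E. Qed.

Lemma zmat_coord (a : R) (b : C R) (f : R) : (acoord (zmat a b f) = a) *
  (bcoord (zmat a b f) = b) * (fcoord (zmat a b f) = f).
Proof. by rewrite /acoord /bcoord /fcoord /zmat !mx5E. Qed.

(* [nmat] and [zmat] both have this shape. *)
Definition tri5 (u v e w x f b a : R[i]) : 'M[R[i]]_5 := mx5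
  [:: [:: u; 0; 0; 0; f]; [:: 0; v; 0; 0; 0]; [:: 0; 0; e; 0; b];
      [:: 0; 0; 0; w; a]; [:: 0; 0; 0; 0; x]].

Lemma tri5M (u v e w x f b a u' v' e' w' x' f' b' a' : R[i]) :
  tri5 u v e w x f b a *m tri5 u' v' e' w' x' f' b' a' =
  tri5 (u * u') (v * v') (e * e') (w * w') (x * x')
    (u * f' + f * x') (e * b' + b * x') (w * a' + a * x').
Proof.
by apply/matrixP; apply: ord5_ind; apply: ord5_ind;
  rewrite mxE sum5 /tri5 !mx5E//= !(mulr0, mul0r, addr0, add0r).
Qed.

Lemma tri5B (u v e w x f b a u' v' e' w' x' f' b' a' : R[i]) :
  tri5 u v e w x f b a - tri5 u' v' e' w' x' f' b' a' =
  tri5 (u - u') (v - v') (e - e') (w - w') (x - x')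
    (f - f') (b - b') (a - a').
Proof.
by apply/matrixP; apply: ord5_ind; apply: ord5_ind;
  rewrite [LHS]mxE [X in _ + X]mxE /tri5 !mx5E//= subrr.
Qed.

Lemma nmatE (a : R) (b : C R) (f : R) :
  nmat a b f = tri5 1 1 (expj a) 1 1 f%:C b a%:C.
Proof. by []. Qed.

Lemma zmatE (a : R) (b : C R) (f : R) :
  zmat a b f = tri5 0 0 (j R * a%:C) 0 0 f%:C b a%:C.
Proof. by []. Qed.

Lemma nmatM (a : R) (b : C R) (f a' : R) (b' : C R) (f' : R) :
  nmat a b f *m nmat a' b' f' = nmat (a + a') (expj a * b' + b) (f + f').
Proof.
rewrite !nmatE tri5M !mulr1 !mul1r -expjD.
by congr tri5; rewrite [RHS]rmorphD addrC.
Qed.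

Lemma nmat1 : nmat 0 0 0 = 1%:M :> 'M[R[i]]_5.
Proof.
apply/matrixP; apply: ord5_ind; apply: ord5_ind; rewrite /nmat mx5E//= mxE
  -val_eqE /= !inordK//=; exact: expj0.
Qed.

Lemma invmx_nmat (a : R) (b : C R) (f : R) :
  invmx (nmat a b f) = nmat (- a) (- (expj (- a) * b)) (- f).
Proof.
have e : nmat a b f *m nmat (- a) (- (expj (- a) * b)) (- f) = 1%:M.
  by rewrite nmatM mulrN mulrA -expjD !subrr expj0 mul1r addNr nmat1.
have [u _] := mulmx1_unit e.
by rewrite -[LHS]mulmx1 -e mulKmx.
Qed.

Lemma zmat_conj (a : R) (b : C R) (f al : R) (be : C R) (ph : R) :
  invmx (nmat a b f) *m zmat al be ph *m nmat a b f =
  zmat al (expj (- a) * (j R * al%:C * b + be)) ph.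
Proof.
rewrite invmx_nmat zmatE !nmatE !tri5M !(mulr0, mul0r, mulr1, mul1r, addr0, add0r).
congr tri5; first by rewrite mulrAC -expjD addNr expj0 mul1r.
by rewrite mulrDr !mulrA.
Qed.

Lemma zmat_bracket (a : R) (b : C R) (f a' : R) (b' : C R) (f' : R) :
  bracket (zmat a b f) (zmat a' b' f') =
  zmat 0 (j R * a%:C * b' - j R * a'%:C * b) 0.
Proof.
rewrite /bracket !zmatE !tri5M tri5B !(mulr0, mul0r, addr0, subrr).
by congr tri5; rewrite [_ * (j R * _)]mulrC subrr.
Qed.

End GroupN.

(** * The orbit U and its 2-form *)

Section CoadjointAction.
Variable R : realType.

(* The translation of [p] under the action of [nmat a b f]. *)
Definition pshift (a : R) (b : C R) (q : R) : R :=
  pi *+ 2 * (complex.Re b * sin (pi *+ 2 * (q + a))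
             - complex.Im b * cos (pi *+ 2 * (q + a))).

Lemma pshiftE (a : R) (b : C R) (q : R) :
  complex.Re (conjc (j R * b) * expj (q + a)) = pshift a b q.
Proof. by case: b => b1 b2; rewrite /pshift /expj /j /=; ring. Qed.

Lemma pairing_uparam (p q a : R) (b : C R) (f : R) :
  pairing (uparam p q) (zmat a b f) = p * a
  + (complex.Re b * cos (pi *+ 2 * q) + complex.Im b * sin (pi *+ 2 * q)) - f.
Proof.
rewrite /pairing /uparam !zmat_coord mul1r; congr (_ + _ - _).
by case: b => b1 b2 /=; ring.
Qed.

Lemma coadjoint_uparam (a : R) (b : C R) (f p q : R) :
  coadjoint (nmat a b f) (uparam p q) (uparam (p + pshift a b q) (q + a)).
Proof.
move=> _ [al [be [ph ->]]]; rewrite -/(zmat al be ph) zmat_conj !pairing_uparam.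
congr (_ - _); rewrite /pshift /expj /j mulrN cosN sinN !mulrDr cosD sinD.
by case: b be => b1 b2 [e1 e2] /=; ring.
Qed.

Lemma pairing_inj (x y : dual R) :
  (forall Z, nalg Z -> pairing x Z = pairing y Z) -> x = y.
Proof.
case: x y => -[p [z1 z2]] t [[p' [z1' z2']] t'] h.
have hz a b f : pairing (p, Complex z1 z2, t) (zmat a b f) =
    pairing (p', Complex z1' z2', t') (zmat a b f).
  by apply: h; apply/nalgP; exists a, b, f.
have := hz 1 0 0; have := hz 0 1 0; have := hz 0 (Complex 0 1) 0; have := hz 0 0 1.
rewrite /pairing !zmat_coord /= => e1 e2 e3 e4.
by congr (_, Complex _ _, _); lra.
Qed.

Lemma coadjoint_orbit_U : coadjoint_orbit (@U R).
Proof.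
exists (uparam 0 0); apply/seteqP; split=> [_ [p [q ->]]|y [_ [a [b [f ->]]] hy]].
  (* [pshift q b 0] is [pi *+ 2] times the scalar product of [b] with the unit vector (sin, -cos) of
     the angle of [q], so [b] is taken along that vector with length fitted to [p]. *)
  pose b := Complex (p * sin (pi *+ 2 * q) / (pi *+ 2))
    (- (p * cos (pi *+ 2 * q) / (pi *+ 2))) : C R.
  exists (nmat q b 0); first by exists q, b, 0.
  have := coadjoint_uparam q b 0 0 0; rewrite !add0r.
  suff -> : pshift q b 0 = p by [].
  have p0 : (pi *+ 2 : R) != 0 by rewrite mulrn_eq0 /= gt_eqF// pi_gt0.
  rewrite /pshift /b /= add0r; have := cos2Dsin2 (pi *+ 2 * q).
  move: (cos _) (sin _) => c s cs.
  transitivity (p * (c ^+ 2 + s ^+ 2)); last by rewrite cs mulr1.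
  clear b; move: p0; move: (pi *+ 2) => w w0; by field.
have := coadjoint_uparam a b f 0 0.
rewrite !add0r => h; exists (pshift a b 0), a.
by apply: pairing_inj => Z nZ; rewrite hy// h.
Qed.

Lemma cos2pi_derive (x : R) : is_derive x 1 (fun t : R => cos (pi *+ 2 * t) : R^o)
  (pi *+ 2 * - sin (pi *+ 2 * x)).
Proof.
have d : is_derive x 1 (fun t : R => pi *+ 2 * t : R^o) (pi *+ 2 * 1 : R^o).
  by apply: is_deriveZ.
by have := is_derive_comp d (is_derive_cos (pi *+ 2 * x)); rewrite mulr1.
Qed.

Lemma sin2pi_derive (x : R) : is_derive x 1 (fun t : R => sin (pi *+ 2 * t) : R^o)
  (pi *+ 2 * cos (pi *+ 2 * x)).
Proof.
have d : is_derive x 1 (fun t : R => pi *+ 2 * t : R^o) (pi *+ 2 * 1 : R^o).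
  by apply: is_deriveZ.
by have := is_derive_comp d (is_derive_sin (pi *+ 2 * x)); rewrite mulr1.
Qed.

Lemma coadjoint_vec_zmat (p q dp dq a : R) (b : C R) (f : R) :
  coadjoint_vec (zmat a b f) p q dp dq ->
  dq = a /\ dp = complex.Re (conjc (expj q) * (j R * b)).
Proof.
move=> h.
have hz (al : R) (be : C R) : dp * al
    + dq * (pi *+ 2 * (complex.Im be * cos (pi *+ 2 * q)
                      - complex.Re be * sin (pi *+ 2 * q)))
    = pairing (uparam p q) (bracket (zmat al be 0) (zmat a b f)).
  rewrite -h; last by apply/nalgP; exists al, be, 0.
  rewrite derive1E.
  have dl (x y : R) : is_derive (0 : R) (1 : R) (fun t : R => x + t * y : R^o) (y : R^o).
    have d2 : is_derive (0 : R) (1 : R) (fun t : R => y * t : R^o) (y * 1 : R^o).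
      by apply: is_deriveZ.
    have := is_deriveD (is_derive_cst (x : R^o) (0 : R) (1 : R)) d2.
    rewrite add0r mulr1; congr (is_derive _ _ _ _).
    by apply/funext => t; rewrite !fctE mulrC.
  have dc := is_derive_comp (dl q dq) (cos2pi_derive (q + 0 * dq)).
  have ds := is_derive_comp (dl q dq) (sin2pi_derive (q + 0 * dq)).
  rewrite mul0r addr0 in dc ds.
  have d1 := is_deriveZ al (dl p dp).
  have d2 := is_deriveD (is_deriveZ (complex.Re be) dc) (is_deriveZ (complex.Im be) ds).
  have := is_deriveB (is_deriveD d1 d2) (is_derive_cst (0 : R^o) (0 : R) (1 : R)).
  set D := (X in is_derive _ _ _ X).
  set F := (X in is_derive _ _ X _) => -[_ e].
  rewrite (_ : (fun t => _) = F).
    by rewrite e /D /GRing.scale /=; ring.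
  apply/funext => t; rewrite pairing_uparam /F !fctE /=.
  by congr (_ + _ - _); exact: mulrC.
have p0 : (pi *+ 2 : R) != 0 by rewrite mulrn_eq0 /= gt_eqF// pi_gt0.
have cs := cos2Dsin2 (pi *+ 2 * q).
(* The first test element is tangent to the circle at [expj q] and isolates [dq]; the second, with
   [al = 1], isolates [dp]. *)
have := hz 0 (Complex (- sin (pi *+ 2 * q)) (cos (pi *+ 2 * q))).
have := hz 1 0; rewrite !zmat_bracket !pairing_uparam /expj /j /=.
move: (cos _) (sin _) cs => c s cs; case: (b) => b1 b2 /= h1 h2; split.
  apply: (mulfI p0); transitivity (pi *+ 2 * dq * (c ^+ 2 + s ^+ 2)).
    by rewrite cs mulr1.
  transitivity (pi *+ 2 * a * (c ^+ 2 + s ^+ 2)); last by rewrite cs mulr1.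
  by move: h2; lra.
by move: h1; lra.
Qed.

Lemma orbit_form_dpdqP : orbit_form_dpdq R.
Proof.
move=> _ _ [a [b [f ->]]] [a' [b' [f' ->]]] p q dp dq dp' dq'.
rewrite -/(zmat a b f) -/(zmat a' b' f').
move=> /coadjoint_vec_zmat[-> ->] /coadjoint_vec_zmat[-> ->].
rewrite zmat_bracket pairing_uparam /expj /j.
by case: b b' => b1 b2 [b1' b2'] /=; ring.
Qed.

End CoadjointAction.

(** * The hamiltonian action *)

Lemma image_nbhs (E B : topologicalType) (p : E -> B) (x : E) (A : set E) :
  (forall A, open A -> open (p @` A)) -> nbhs x A -> nbhs (p x) (p @` A).
Proof.
move=> op; rewrite nbhsE => -[V [oV Vx] VA].
apply: (@filterS _ _ _ (p @` V)); first exact: image_subset.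
by apply: open_nbhs_nbhs; split; [exact: op|exists x].
Qed.

Section HamiltonianX.
Variable R : realType.

Lemma pshift_int (a : R) (b : C R) (q : R) (k : int) :
  pshift a b (q + k%:~R) = pshift a b q.
Proof.
have [c s] : expj (q + k%:~R + a) = expj (q + a).
  by apply/esym/expj_eqP; exists k; rewrite addrAC.
by rewrite /pshift c s.
Qed.

Let act (a : R) (b : C R) := shear (pshift a b) a 0 0 0.

(** The translation of p has period 1 in q, and r and s are left alone; hence the action descends to
    X. *)
Lemma act_deck a b g y : act a b (deck g y) = deck g (act a b y).
Proof.
case: g => -[k l] m; apply: row4P;
  by rewrite /act /shear !(deckE, row4E) ?pshift_int; ring.
Qed.

Lemma Mact_param (a : R) (b : C R) (f : R) y :
  Mact (nmat a b f) (Mparam y) = Mparam (act a b y).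
Proof.
rewrite /Mact /Mparam /plane_act !nmat_coord pshiftE /act /shear !row4E.
by rewrite mul0r !addr0.
Qed.

Lemma repr_Xparam (y : 'rV[R]_4) : exists g, repr (Xparam y) = Mparam (deck g y).
Proof.
have [z zy] := Mparam_surj (repr (Xparam y)).
have /Xparam_eqP[g zg] : Xparam y = Xparam z.
  by rewrite {2}/Xparam zy /Defs.proj reprK.
by exists g; rewrite -zy zg.
Qed.

Lemma Xact_param (a : R) (b : C R) (f : R) y :
  Xact (nmat a b f) (Xparam y) = Xparam (act a b y).
Proof.
rewrite /Xact; have [g ->] := repr_Xparam y; rewrite Mact_param act_deck.
by apply/esym/Xparam_eqP; exists g.
Qed.

Lemma Xmom_param (y : 'rV[R]_4) : Xmom (Xparam y) = uparam (y 0 (inord 0)) (y 0 (inord 1)).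
Proof.
rewrite /Xmom; have [[[k l] m] ->] := repr_Xparam y; rewrite /Mmom /Mparam deckE.
by apply/uparam_inj; split=> //; exists (- k); rewrite deckE intrN addrK.
Qed.

Lemma Xparam_quotient : deck_quotient setT (@Xparam R).
Proof.
by move=> u v; rewrite Xparam_eqP; split=> [[g]|[g _]]; exists g.
Qed.

Lemma Xact1 (x : X R) : Xact 1%:M x = x.
Proof.
have [y <-] := Xparam_surj x; rewrite -nmat1 Xact_param; congr Xparam.
apply: row4P; rewrite /act /shear !row4E; rewrite /pshift /=; ring.
Qed.

Lemma XactM (g h : 'M[R[i]]_5) (x : X R) :
  N g -> N h -> Xact (g *m h) x = Xact g (Xact h x).
Proof.
move=> [a [b [f ->]]] [a' [b' [f' ->]]]; have [y <-] := Xparam_surj x.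
rewrite nmatM !Xact_param; congr Xparam.
apply: row4P; rewrite /act /shear !row4E; try ring.
rewrite -!pshiftE.
set q := y 0 (inord 1).
(* Grouping the angles as [a] plus [q + a'] lets the addition formulas separate the rotation of [b']
   by [expj a] in the product from the advance of the angle; the two cancel through cos^2 + sin^2 =
   1. *)
have -> : q + a' + a = a + (q + a') by ring.
have -> : q + (a + a') = a + (q + a') by ring.
rewrite (expjD a (q + a')) /j /expj.
have := cos2Dsin2 (pi *+ 2 * a).
case: b b' => b1 b2 [e1 e2] /= cs.
move: (cos _) (sin _) cs => ca sa cs; move: (cos _) (sin _) => cq sq.
set w := (pi *+ 2 : R).
transitivity (y 0 (inord 0) + (w * (sq * e1 - cq * e2)) * (ca ^+ 2 + sa ^+ 2)
   + w * (b1 * (sq * ca + cq * sa) - b2 * (ca * cq - sa * sq))); first by ring.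
by rewrite cs; ring.
Qed.

(* The coordinates of [w] are [(a, Re b, Im b, f)] followed by those of the
   point; [f] acts trivially. *)
Let act8 (w : 'rV[R]_(4 + 4)) : 'rV[R]_4 :=
  act (lsubmx w 0 (inord 0)) (Complex (lsubmx w 0 (inord 1)) (lsubmx w 0 (inord 2)))
    (rsubmx w).

Lemma act8_smooth k i : C_k k setT (fun w => act8 w 0 i : R^o).
Proof.
have cl (i' : 'I_4) : C_k k setT (fun w : 'rV[R]_(4 + 4) => lsubmx w 0 i' : R^o).
  by apply: (eq_C_k (@C_k_coord R _ k (lshift 4 i'))) => w; rewrite mxE.
have cr (i' : 'I_4) : C_k k setT (fun w : 'rV[R]_(4 + 4) => rsubmx w 0 i' : R^o).
  by apply: (eq_C_k (@C_k_coord R _ k (rshift 4 i'))) => w; rewrite mxE.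
have cc (c : R) := @C_k_cst R (4 + 4) k _ (c : R^o).
have ca := C_k_add (cr (inord 1)) (cl (inord 0)).
have [ccos csin] := C_k_cos_sin (C_k_mul (cc (pi *+ 2)) ca).
move: i; apply: ord4_ind.
- apply: (eq_C_k (C_k_add (cr (inord 0)) (C_k_mul (cc (pi *+ 2))
    (C_k_add (C_k_mul (cl (inord 1)) csin)
      (C_k_mul (cc (-1)) (C_k_mul (cl (inord 2)) ccos)))))) => w.
  by rewrite /act8 /act /shear row4E /pshift /= mulN1r.
- by apply: (eq_C_k ca) => w; rewrite /act8 /act /shear row4E.
- apply: (eq_C_k (cr (inord 2))) => w.
  by rewrite /act8 /act /shear row4E mul0r !addr0.
- apply: (eq_C_k (cr (inord 3))) => w.
  by rewrite /act8 /act /shear row4E addr0.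
Qed.

(** Parametrizing N and X jointly turns smoothness of the action into smoothness of [act8] between
    the parameter spaces. *)
Let pi8 (w : 'rV[R]_(4 + 4)) : 'rV[R]_4 * X R := (lsubmx w, Xparam (rsubmx w)).

Lemma lsubmx_continuous m n : continuous (@lsubmx R 1 m n).
Proof.
apply: row_continuous => i; under eq_fun do rewrite mxE; exact: coord_continuous.
Qed.

Lemma rsubmx_continuous m n : continuous (@rsubmx R 1 m n).
Proof.
apply: row_continuous => i; under eq_fun do rewrite mxE; exact: coord_continuous.
Qed.

Lemma row_mx_continuous m n :
  continuous (fun z : 'rV[R]_m * 'rV[R]_n => row_mx z.1 z.2).
Proof.
apply: row_continuous => i; case: (split_ordP i) => i' ->.
  under eq_fun do rewrite row_mxEl.
  exact: (comp_continuous (@fst_continuous _ _) (@coord_continuous R 1 m 0 i')).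
under eq_fun do rewrite row_mxEr.
exact: (comp_continuous (@snd_continuous _ _) (@coord_continuous R 1 n 0 i')).
Qed.

Lemma prod_chart_is_chart (E F : topologicalType) m n (c : chart R E m)
    (d : chart R F n) : is_chart c -> is_chart d -> is_chart (prod_chart c d).
Proof.
move=> [oc ic cc vc ck] [od id_ cd vd dk].
have oCD : open (cdom c `*` cdom d).
  exact: (openI (open_preimage (@fst_continuous E F) oc)
    (open_preimage (@snd_continuous E F) od)).
have imgE : cimg (prod_chart c d) =
    (lsubmx @^-1` cimg c) `&` (rsubmx @^-1` cimg d).
  apply/seteqP; split=> [_ [[x y] [/= cx dy] <-]|w [[x cx xw] [y dy yw]]].
    by rewrite /= row_mxKl row_mxKr; split; [exists x|exists y].
  by exists (x, y) => //=; rewrite xw yw hsubmxK.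
have oimg : open (cimg (prod_chart c d)).
  by rewrite imgE; apply: openI; apply: open_preimage => //;
    [exact: lsubmx_continuous|exact: rsubmx_continuous].
rewrite !continuous_open_subspace// in cc vc cd vd.
split=> //.
- rewrite continuous_open_subspace// => -[x y]; rewrite inE => -[/= cx dy].
  apply: (@continuous_comp _ _ _ (fun xy => (cmap c xy.1, cmap d xy.2))
    (fun z => row_mx z.1 z.2)); last exact: row_mx_continuous.
  apply: pair_continuous_at.
    by apply: (@continuous_comp _ _ _ fst (cmap c));
      [exact: fst_continuous|apply: cc; rewrite inE].
  by apply: (@continuous_comp _ _ _ snd (cmap d));
    [exact: snd_continuous|apply: cd; rewrite inE].
- rewrite continuous_open_subspace// => w; rewrite inE imgE => -[/= cw dw].
  apply: (@pair_continuous_at _ _ _ (cinv c \o lsubmx) (cinv d \o rsubmx)).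
    by apply: (@continuous_comp _ _ _ lsubmx (cinv c));
      [exact: lsubmx_continuous|apply: vc; rewrite inE].
  by apply: (@continuous_comp _ _ _ rsubmx (cinv d));
    [exact: rsubmx_continuous|apply: vd; rewrite inE].
- by move=> [x y] [/= cx dy]; rewrite row_mxKl row_mxKr ck// dk.
Qed.

Lemma vec_chart n : is_chart (Chart setT id id : chart R 'rV[R]_n n).
Proof.
have e : cimg (Chart setT id id : chart R 'rV[R]_n n) = setT.
  by apply/seteqP; split=> // x _; exists x.
split=> //=; rewrite ?e; try exact: openT;
  by apply: continuous_subspaceT => x; exact: cvg_id.
Qed.

Lemma prod_atlas_param :
  prod_atlas (vec_atlas (R := R) (n := 4)) (@Xatlas R) `<=` param_atlas pi8.
Proof.
move=> _ [_ [d [-> [hd dE] ->]]]; split.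
  by apply: prod_chart_is_chart => //; exact: vec_chart.
move=> _ [[x y] [_ /= dy] <-] /=; rewrite /pi8 row_mxKl row_mxKr.
by rewrite dE//; exists y.
Qed.

Lemma pi8_open (A : set 'rV[R]_(4 + 4)) : open A -> open (pi8 @` A).
Proof.
move: A; apply: open_map_nbhs => w A nA.
have nA' : nbhs (lsubmx w, rsubmx w)
    ((fun z : 'rV[R]_4 * 'rV[R]_4 => row_mx z.1 z.2) @^-1` A).
  by apply: row_mx_continuous; rewrite /= hsubmxK.
case: nA' => -[P Q] [/= nP nQ] PQA.
have nQ' : nbhs (Xparam (rsubmx w)) (@Xparam R @` Q).
  exact: (image_nbhs (@Xparam_open R) nQ).
apply: filterS (nbhs_setX nP nQ') => -[x _] [/= Px [y Qy <-]].
by exists (row_mx x y); [exact: (PQA (x, y))|rewrite /pi8 row_mxKl row_mxKr].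
Qed.

Lemma pi8_surj z : exists w, pi8 w = z.
Proof.
case: z => x u; have [y <-] := Xparam_surj u.
by exists (row_mx x y); rewrite /pi8 row_mxKl row_mxKr.
Qed.

Lemma act_smooth : smooth_map (prod_atlas (vec_atlas (R := R) (n := 4)) (@Xatlas R))
  (@Xatlas R) (fun yx => Xact (nparam yx.1) yx.2).
Proof.
have FG w : Xact (nparam (pi8 w).1) (pi8 w).2 = Xparam (act8 w).
  by rewrite /pi8 /nparam /= Xact_param.
apply: (lifted_map_smooth (phi := pi8) (G := act8) Xparam_quotient FG).
- exact: prod_atlas_param.
- apply: (open_quotient_continuous pi8_open pi8_surj).
  rewrite (_ : _ \o pi8 = @Xparam R \o act8); last exact/funext.
  apply: comp_continuous; last exact: Xparam_continuous.
  by apply: row_continuous => i w; exact: (C_k_continuous (act8_smooth 0 i)).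
- exact: act8_smooth.
Qed.

Lemma pshift_derivable (a : R) (b : C R) (t : R) : derivable (pshift a b) t 1.
Proof.
have d1 : is_derive t (1 : R) (fun q : R => q + a : R^o) (1 + 0 : R^o).
  exact: (is_deriveD (is_derive_id t (1 : R)) (is_derive_cst (a : R^o) t (1 : R))).
have dc := is_derive_comp d1 (cos2pi_derive (t + a)).
have ds := is_derive_comp d1 (sin2pi_derive (t + a)).
have [d _] := is_deriveZ (pi *+ 2 : R) (is_deriveB (is_deriveZ (complex.Re b) ds)
  (is_deriveZ (complex.Im b) dc)).
exact: d.
Qed.

Lemma Xact_pullback (g : 'M[R[i]]_5) :
  N g -> is_pullback (@Xatlas R) (@Xform R) (@Xatlas R) (@Xform R) (Xact g).
Proof.
move=> [a [b [f ->]]].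
apply: (lifted_map_pullback (pi := @Xparam R) (pi' := @Xparam R) (f := pshift a b)
  (a := a) Xparam_quotient); first exact: Xact_param.
exact: pshift_derivable.
Qed.

End HamiltonianX.

(** * The moment map, and closedness of the identifications *)

Section MomentX.
Variable R : realType.

Lemma moment_derive (al be1 be2 f : R) (y v : 'rV[R]_4) :
  is_derive y v (fun y : 'rV[R]_4 => y 0 (inord 0) * al
      + (be1 * cos (pi *+ 2 * y 0 (inord 1)) + be2 * sin (pi *+ 2 * y 0 (inord 1)))
      - f : R^o)
    (v 0 (inord 0) * al + v 0 (inord 1) * (pi *+ 2 *
      (be2 * cos (pi *+ 2 * y 0 (inord 1)) - be1 * sin (pi *+ 2 * y 0 (inord 1))))).
Proof.
have d0 := is_deriveZ al (is_derive_coord (inord 0) y v).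
have dc := is_deriveZ be1
  (is_derive_comp (is_derive_coord (inord 1) y v) (cos2pi_derive _)).
have ds := is_deriveZ be2
  (is_derive_comp (is_derive_coord (inord 1) y v) (sin2pi_derive _)).
have := is_deriveB (is_deriveD d0 (is_deriveD dc ds)) (is_derive_cst (f : R^o) y v).
set D := (X in is_derive _ _ _ X); set D' := (X in _ -> is_derive _ _ _ X).
have -> : D = D' by rewrite /D /D' /GRing.scale /=; ring.
congr (is_derive _ _ _ _); apply/funext => z; rewrite !fctE /=.
by congr (_ + _ - _); exact: mulrC.
Qed.

(** The velocity at time 0 of the lifted orbit along [ncurve]. The translation of p carries a factor
    [t] from [b], so its derivative at 0 sees the angle only at [a = 0]. *)
Lemma orbit_derive (al : R) (be : C R) (y : 'rV[R]_4)
    (g := fun t : R => shear (pshift (t * al) (t%:C * be)) (t * al) 0 0 0 y) :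
  derivable g 0 1 /\ derive1 g 0 = row4 (pshift 0 be (y 0 (inord 1))) al 0 0.
Proof.
pose q := y 0 (inord 1).
have dl (x z : R) : is_derive (0 : R) (1 : R) (fun t : R => x + t * z : R^o) (z : R^o).
  have d2 : is_derive (0 : R) (1 : R) (fun t : R => z * t : R^o) (z * 1 : R^o).
    by apply: is_deriveZ.
  have := is_deriveD (is_derive_cst (x : R^o) (0 : R) (1 : R)) d2.
  rewrite add0r mulr1; congr (is_derive _ _ _ _).
  by apply/funext => t; rewrite !fctE mulrC.
have dc := is_derive_comp (dl q al) (cos2pi_derive (q + 0 * al)).
have ds := is_derive_comp (dl q al) (sin2pi_derive (q + 0 * al)).
have dcst (k : R) := is_derive_cst (k : R^o) (0 : R) (1 : R).
have dp : is_derive (0 : R) (1 : R) (fun t : R => y 0 (inord 0)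
    + pshift (t * al) (t%:C * be) q : R^o) (pshift 0 be q).
  have hs := is_deriveZ (complex.Re be) (is_deriveM (is_derive_id (0 : R) (1 : R)) ds).
  have hc := is_deriveZ (complex.Im be) (is_deriveM (is_derive_id (0 : R) (1 : R)) dc).
  have := is_deriveD (dcst (y 0 (inord 0))) (is_deriveZ (pi *+ 2 : R) (is_deriveB hs hc)).
  set D := (X in is_derive _ _ _ X); set D' := (X in _ -> is_derive _ _ _ X).
  have -> : D = D'.
    by rewrite /D /D' /pshift /GRing.scale /= !mul0r !addr0; ring.
  congr (is_derive _ _ _ _); apply/funext => t; rewrite !fctE /pshift /=.
  have scE (a b : R) : a *: (b : R^o) = a * b by [].
  by case: (be) => b1 b2 /=; rewrite !scE; ring.
have dq := dl q al.
have gd : derivable g 0 1.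
  apply/derivable_mxP => i; rewrite (ord1 i); apply: ord4_ind; rewrite /g /shear;
    under eq_fun do rewrite row4E.
  - by case: dp.
  - by case: dq.
  - by case: (dcst (y 0 (inord 2) + 0 * y 0 (inord 3) + 0)).
  - by case: (dcst (y 0 (inord 3) + 0)).
split=> //; rewrite derive1E derive_mx//.
apply/rowP; apply: ord4_ind; rewrite mxE row4E /g /shear;
    under eq_fun do rewrite row4E.
- by case: dp.
- by case: dq.
- by case: (dcst (y 0 (inord 2) + 0 * y 0 (inord 3) + 0)).
- by case: (dcst (y 0 (inord 3) + 0)).
Qed.

Lemma X_moment_map : moment_map (@Xatlas R) (@Xform R) (@Xact R) (@Xmom R).
Proof.
move=> _ [al [be [f ->]]] c [hc cE0] H; rewrite -/(zmat al be f) in H *.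
have cE y : cimg c y -> cinv c y = Xparam y := cE0 y.
have [od oi _ _ ck] := hc.
pose h (y : 'rV[R]_4) := y 0 (inord 0) * al
  + (complex.Re be * cos (pi *+ 2 * y 0 (inord 1))
     + complex.Im be * sin (pi *+ 2 * y 0 (inord 1))) - f : R^o.
have hH y : cimg c y -> {near y, h =1 H}.
  move=> cy; apply: filterS (open_nbhs_nbhs (conj oi cy)) => z cz.
  by rewrite /H cE// Xmom_param pairing_uparam.
split.
  split=> // k; apply: C_k_local => y cy; exists h; last exact: hH.
  have cc (b : R) := @C_k_cst R 4 k _ (b : R^o).
  have [ccos csin] := C_k_cos_sin (C_k_mul (cc (pi *+ 2)) (@C_k_coord R 4 k (inord 1))).
  exact: (C_k_add (C_k_add (C_k_mul (@C_k_coord R 4 k (inord 0)) (cc al))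
    (C_k_add (C_k_mul (cc _) ccos) (C_k_mul (cc _) csin))) (cc (- f))).
move=> x v cx; set y := cmap c x.
have cy : cimg c y by exists x.
have xy : Xparam y = x by rewrite -(ck x cx) cE.
rewrite -(near_eq_derive v (hH y cy)).
have [_ ->] := moment_derive al (complex.Re be) (complex.Im be) f y v.
pose g (t : R) := shear (pshift (t * al) (t%:C * be)) (t * al) 0 0 0 y.
have [gd g'] := orbit_derive al be y.
have g0 : g 0 = y.
  apply: row4P; rewrite /g /shear !row4E ?mul0r ?addr0//.
  by rewrite /pshift; case: (be) => b1 b2 /=; ring.
(* For small [t] the lifted orbit [g] stays in the image of the chart, which therefore reads the
   orbit in X as [g] itself. *)
have ng : {near (0 : R), g =1
    (fun t => cmap c (Xact (ncurve (zmat al be f) t) x))}.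
  have cg : {for 0, continuous g}.
    by apply: differentiable_continuous; exact/derivable1_diffP.
  have : nbhs (0 : R) (g @^-1` cimg c).
    by apply: cg; rewrite g0; apply: open_nbhs_nbhs.
  apply: filterS => t gt.
  rewrite /ncurve !zmat_coord -xy Xact_param.
  have [gK _] := chart_mapK hc gt.
  by rewrite -[in LHS]gK cE.
have -> : fund_vec (@Xact R) (zmat al be f) c x =
    row4 (pshift 0 be (y 0 (inord 1))) al 0 0.
  rewrite -g' /fund_vec !derive1E; apply/esym.
  exact: (near_eq_derive (1 : R) ng).
rewrite /Xform mul_Omega !row4E /pshift addr0; ring.
Qed.

Lemma X_equivariant : equivariant_moment (@Xact R) (@Xmom R).
Proof.
move=> _ x [a [b [f ->]]]; have [y <-] := Xparam_surj x.
by rewrite Xact_param !Xmom_param /shear !row4E; exact: coadjoint_uparam.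
Qed.

Lemma closed_preimage_point (T : topologicalType) (h : T -> R) (a : R) :
  continuous h -> closed [set x | h x = a].
Proof.
move=> ch; rewrite (_ : [set x | _] = h @^-1` [set a])//.
apply: preimage_closed; first by move=> x _; exact: ch.
exact: closed_eq.
Qed.

(** Together with [expj_eq1P] this makes integrality of [h] a closed condition, so that the
    infinitely many deck transformations are handled at once. *)
Lemma closed_expj (T : topologicalType) (h : T -> R) :
  continuous h -> closed [set x | expj (h x) = 1].
Proof.
move=> ch.
rewrite (_ : [set x | _] = [set x | cos (pi *+ 2 * h x) = 1] `&`
    [set x | sin (pi *+ 2 * h x) = 0]).
  by apply: closedI; apply: closed_preimage_point;
    [exact: (comp_continuous ch (@cos2pi_continuous R))|
     exact: (comp_continuous ch (@sin2pi_continuous R))].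
by apply/seteqP; split=> x /=; rewrite /expj; case=> -> ->.
Qed.

Lemma expj_eq1P (t : R) : expj t = 1 <-> exists k : int, t = k%:~R.
Proof. by split=> [/expj_eq1//|[k ->]]; exact: expj_int. Qed.

Let co1 (i : 'I_4) : continuous (fun xy : 'rV[R]_4 * 'rV[R]_4 => xy.1 0 i).
Proof. exact: (comp_continuous (@fst_continuous _ _) (@coord_continuous R 1 4 0 i)). Qed.

Let cod (i : 'I_4) :
  continuous (fun xy : 'rV[R]_4 * 'rV[R]_4 => xy.2 0 i - xy.1 0 i).
Proof.
apply: addr_continuous; last exact: oppr_continuous.
exact: (comp_continuous (@snd_continuous _ _) (@coord_continuous R 1 4 0 i)).
Qed.

Lemma Xparam_closed :
  closed [set xy : 'rV[R]_4 * 'rV[R]_4 | Xparam xy.1 = Xparam xy.2].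
Proof.
pose d (i : 'I_4) (xy : 'rV[R]_4 * 'rV[R]_4) := xy.2 0 i - xy.1 0 i.
(* The change of r minus the shear: for a pair related by [deck (k, l, m)] the change of q is [k],
   and this difference is [l]. *)
pose e xy := d (inord 2) xy - d (inord 1) xy * xy.1 0 (inord 3).
rewrite (_ : [set xy | _] = ([set xy | d (inord 0) xy = 0] `&`
  [set xy | expj (d (inord 1) xy) = 1]) `&` ([set xy | expj (e xy) = 1] `&`
  [set xy | expj (d (inord 3) xy) = 1])).
  apply: closedI; apply: closedI.
  - by apply: closed_preimage_point; exact: cod.
  - by apply: closed_expj; exact: cod.
  - apply: closed_expj; apply: addr_continuous; first exact: cod.
    by apply: oppr_continuous; apply: mulr_continuous; [exact: cod|exact: co1].
  - by apply: closed_expj; exact: cod.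
apply/seteqP; split=> -[x y] /=.
  move=> /Xparam_eqP[[[k l] m] ->]; rewrite /e /d /= !deckE.
  split; first by split; [rewrite subrr|apply/expj_eq1P; exists k; ring].
  by split; apply/expj_eq1P; [exists l|exists m]; ring.
move=> [[d0 /expj_eq1[k d1]] [/expj_eq1[l d2] /expj_eq1[m d3]]].
apply/Xparam_eqP; exists (k, l, m); move: d0 d1 d2 d3; rewrite /e /d /= => d0 d1 d2 d3.
apply: row4P; rewrite deckE.
- by apply/eqP; rewrite -subr_eq0 d0.
- by rewrite -d1 subrKC.
- by rewrite -d2 -d1; ring.
- by rewrite -d3 subrKC.
Qed.

Lemma Mparam_closed :
  closed [set xy : 'rV[R]_4 * 'rV[R]_4 | Mparam xy.1 = Mparam xy.2].
Proof.
pose d (i : 'I_4) (xy : 'rV[R]_4 * 'rV[R]_4) := xy.2 0 i - xy.1 0 i.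
rewrite (_ : [set xy | _] = ([set xy | d (inord 0) xy = 0] `&`
  [set xy | d (inord 1) xy = 0]) `&` ([set xy | expj (d (inord 2) xy) = 1] `&`
  [set xy | expj (d (inord 3) xy) = 1])).
  apply: closedI; apply: closedI.
  - by apply: closed_preimage_point; exact: cod.
  - by apply: closed_preimage_point; exact: cod.
  - by apply: closed_expj; exact: cod.
  - by apply: closed_expj; exact: cod.
apply/seteqP; split=> -[x y] /=.
  move=> /Mparam_eqP[l [m ->]]; rewrite /d /= !deckE mul0r !addr0.
  split; first by rewrite !subrr.
  by split; apply/expj_eq1P; [exists l|exists m]; ring.
move=> [[d0 d1] [/expj_eq1[l d2] /expj_eq1[m d3]]].
apply/Mparam_eqP; exists l, m; move: d0 d1 d2 d3; rewrite /d /= => d0 d1 d2 d3.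
apply: row4P; rewrite deckE.
- by apply/eqP; rewrite -subr_eq0 d0.
- by rewrite addr0; apply/eqP; rewrite -subr_eq0 d1.
- by rewrite -d2 mul0r addr0 subrKC.
- by rewrite -d3 subrKC.
Qed.

Lemma Mparam_quotient : deck_quotient [set g | g.1.1 = 0] (@Mparam R).
Proof.
move=> u v; rewrite Mparam_eqP; split=> [[l [m ->]]|[[[k l] m] /= -> ->]].
  by exists (0, l, m).
by exists l, m.
Qed.

Lemma M_symplectic : symplectic_manifold (@Matlas R) (@Mform R).
Proof.
exact: (param_symplectic (@Mparam_continuous R) (@Mparam_open R)
  (@Mparam_surj R) Mparam_quotient Mparam_closed).
Qed.

Lemma X_symplectic : symplectic_manifold (@Xatlas R) (@Xform R).
Proof.
exact: (param_symplectic (@Xparam_continuous R) (@Xparam_open R)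
  (@Xparam_surj R) (@Xparam_quotient R) Xparam_closed).
Qed.

Lemma X_inducedP : X_induced R.
Proof.
have proj_lift z : Defs.proj (@Mparam R z) = Xparam z by [].
split.
- exact: M_symplectic.
- apply: (lifted_map_smooth (phi := @Mparam R) (G := id)
    (@Xparam_quotient R) proj_lift) => //.
    exact: proj_continuous.
  by move=> k i; exact: C_k_coord.
- apply: (lifted_map_pullback (pi := @Mparam R) (pi' := @Xparam R)
    (f := fun _ => 0) (a := 0) (@Xparam_quotient R)).
    by move=> z; rewrite shear0.
  by move=> t; exact: derivable_cst.
- move=> _ x [a [b [f ->]]]; have [y <-] := Mparam_surj x.
  by rewrite Mact_param [LHS](Xact_param a b f y).
- move=> x; have [y <-] := Mparam_surj x.
  by rewrite [LHS](Xmom_param y).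
Qed.

Lemma X_primary :
  primary_space (@Xatlas R) (@Xform R) (@Xact R) (@Xmom R) (@U R).
Proof.
split; first exact: coadjoint_orbit_U.
- split; first exact: X_symplectic.
  + split; [exact: Xact1|exact: XactM|exact: act_smooth|exact: Xact_pullback].
  + exact: X_moment_map.
  + exact: X_equivariant.
- apply/seteqP; split=> [_ [x _ <-]|_ [p [q ->]]].
    have [y <-] := Xparam_surj x; rewrite Xmom_param.
    by exists (y 0 (inord 0)), (y 0 (inord 1)).
  by exists (Xparam (row4 p q 0 0)) => //; rewrite Xmom_param !row4E.
Qed.

End MomentX.

Theorem mainTheorem7 (R : realType) :
  [/\ orbit_form_dpdq R,
      X_induced R,
      primary_space (@Xatlas R) (@Xform R) (@Xact R) (@Xmom R) (@U R) &
      ~ exists (Y S : topologicalType) (f : Y -> @U R),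
          [/\ covering f, surface R S & homeomorphic (X R) (Y * S)%type]].
Proof.
split; [exact: orbit_form_dpdqP|exact: X_inducedP|exact: X_primary|].
by move=> [Y [S [f [hf _ hom]]]]; exact: (X_not_product hf hom).
Qed.
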